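(* Let $0<p<1$ and let $H$ be a graph on vertex set $[h]=\{1,\dots,h\}$ with $h\ge 2$. For every $\zeta>0$ there exist $\delta>0$ and an integer $N$ such that the following holds. Let $G$ be a graph on $n\ge N$ vertices such that for every $m\ge 1$, every $h$-tuple $U_1,\dots,U_h$ of pairwise disjoint vertex sets of $G$ with $|U_1|=\dots=|U_h|=m$, and every permutation $\sigma$ of $[h]$, $$H^*_{\sigma}[U_1,\dots,U_h]=\delta_H(p)\,m^h\pm \delta n^h .$$ Then either every set $U\subseteq V(G)$ satisfies $e(U)=\tfrac12 p|U|^2\pm\zeta n^2$, or every set $U\subseteq V(G)$ satisfies $e(U)=\tfrac12 \overline{p}_H|U|^2\pm\zeta n^2$.
   Context: $x=y\pm\epsilon$ means $y-\epsilon\le x\le y+\epsilon$. $e(U)$ is the number of edges of $G$ with both endpoints in $U$. $\delta_H(p)=p^{e(H)}(1-p)^{\binom h2-e(H)}$. The conjugate $\overline{p}_H$ is the solution $x\in(0,1)$ of $x^{e(H)}(1-x)^{\binom h2-e(H)}=\delta_H(p)$ other than $x=p$ if such a second solution exists (there are at most two solutions in $(0,1)$), and $\overline{p}_H=p$ otherwise. For pairwise disjoint vertex sets $U_1,\dots,U_h$ of $G$ and a permutation $\sigma$ of $[h]$, $H^*_\sigma[U_1,\dots,U_h]$ denotes the number of $h$-tuples $(v_1,\dots,v_h)$ with $v_i\in U_{\sigma(i)}$ for all $i$ such that, for all $i\ne j$, $v_i$ is adjacent to $v_j$ in $G$ if and only if $\{i,j\}\in E(H)$. (This is the quantitative form of: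 if $G$ has the correct distribution of induced copies of $H$ as in $G(n,p)$, then $G$ is $p$-quasi-random or $\overline{p}_H$-quasi-random.) *)

(* Defs.v *)
From HB Require Import structures.
From mathcomp Require Import all_boot all_order all_algebra.
From mathcomp Require Import fingroup perm.
From mathcomp Require Import boolp classical_sets reals.

Set Implicit Arguments.
Unset Strict Implicit.
Unset Printing Implicit Defensive.

Import Order.TTheory GRing.Theory Num.Theory.
Local Open Scope ring_scope.

Record sgraph (V : finType) := SGraph {
  adj :> rel V;
  adj_sym : symmetric adj;
  adj_irr : irreflexive adj }.

Section Graphs.
Variables (V : finType) (G : sgraph V).

(* Edges are unordered pairs, represented as two-element vertex sets. *)
Definition edges_in (U : {set V}) : {set {set V}} :=
  [set [set x; y] | x in U, y in U & G x y]%SET.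

Definition num_edges_in (U : {set V}) : nat := #|edges_in U|.

End Graphs.

Definition num_edges (V : finType) (G : sgraph V) : nat :=
  num_edges_in G [set: V]%SET.

(* The number H^*_sigma[U_1, ..., U_h] of induced labelled copies of H in G
   whose i-th vertex lies in U_(sigma i). *)
Definition induced_copies (h : nat) (H : sgraph 'I_h) (V : finType)
    (G : sgraph V) (sigma : {perm 'I_h}) (U : 'I_h -> {set V}) : nat :=
  #|[set v : {ffun 'I_h -> V} |
      [forall i, v i \in U (sigma i)] &&
      [forall i, forall j, (i != j) ==> (G (v i) (v j) == H i j)]]%SET|.

Section Density.
Variables (R : realType) (h : nat) (H : sgraph 'I_h).

(* delta_H(p).  The truncated subtraction is harmless: H has at most 'C(h, 2)
   edges. *)
Definition ind_density (p : R) : R :=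
  p ^+ num_edges H * (1 - p) ^+ ('C(h, 2) - num_edges H).

(* The conjugate \overline{p}_H.  [xget p A] is an element of A if A is
   nonempty, and p otherwise; here A has at most one element when
   0 < p < 1 and 1 < h. *)
Definition conj_density (p : R) : R :=
  xget p [set x : R | [/\ 0 < x < 1, ind_density x = ind_density p & x != p]]%classic.

End Density.

(* x = y \pm eps *)
Definition eq_pm (R : realType) (x y eps : R) : bool := y - eps <= x <= y + eps.

(* Main.v *)
Require Import Defs.
From HB Require Import structures.
From mathcomp Require Import all_boot all_order all_algebra.
From mathcomp Require Import fingroup perm.
From mathcomp Require Import polyrcf lra ring zify.
From mathcomp Require Import boolp classical_sets reals.
From mathcomp Require Import topology normedtype derive.

(* Let d = delta_H(p).  A two-level Frieze-Kannan decomposition gives a step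
   kernel w that is cut-close to the adjacency matrix of G and for which the
   hypothesis on small disjoint blocks upgrades, by a counting lemma, to
   prod_(i<j) K_ij(v_i, v_j) = d up to a small L^1 error over v in V^h, where
   K_ij is w on the edges of H and 1 - w on the non-edges.

   Resampling v_i and v_k independently, the products at the two diagonals of
   {x, x'} x {z, z'} have all factors but K_ik in common, whence
   K_ik(x,z) K_ik(x',z') = K_ik(x',z) K_ik(x,z') in L^1.  If H has both an edge
   and a non-edge this holds for w and for 1 - w, so that
   (w(x,z) - w(x',z)) (w(x,z) - w(x,z')) = 0 in L^1, and comparing two
   independent triples of points forces w(x,z) = w(x,z') in L^1; if H is
   complete or empty this follows from d > 0 directly.  Hence w is L^1-close to
   a constant a with delta_H(a) close to d, and by compactness and Rolle's
   theorem a is close to p or to its conjugate. *)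

Set Implicit Arguments.
Unset Strict Implicit.
Unset Printing Implicit Defensive.

Import Order.TTheory GRing.Theory Num.Theory.
Import numFieldNormedType.Exports.
Local Open Scope ring_scope.

(** * Averages over finite types *)

(** The hypothesis controls signed averages over boxes of blocks, whereas the argument for constancy
    needs an L^1 statement. The passage rests on [w] being constant on pairs of atoms: on a box
    whose sides lie in atoms, prod K_ij - d does not change, so the modulus of its average is the
    average of its modulus.

    The error delta n^h is additive, hence useful only for a bounded number of blocks of linear
    size. Every box costs delta plus the error of the counting lemma, and there are up to Q^h boxes,
    with Q exponential in the number of sets generating the partition. One cut-norm approximation
    does not come with an error small against its own complexity. This forces two levels: the fine
    kernel is cut-close to G with a precision chosen after the coarse partition, the coarse kernel
    is L^1-close to the fine one by the energy bound, and only the coarse one has to be constant on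
    blocks.

    The resampling argument never cancels the common factors, for which no pointwise lower bound is
    known: it compares whole products with d and divides by powers of d alone. *)

Definition avg (R : realFieldType) (T : finType) (f : T -> R) : R :=
  (\sum_t f t) / #|T|%:R.

Section Averages.
Variable R : realFieldType.
Implicit Types S T : finType.

Lemma eq_avg T (f g : T -> R) : f =1 g -> avg f = avg g.
Proof. by move=> fg; congr (_ / _); apply: eq_bigr. Qed.

Lemma avgD T (f g : T -> R) : avg (fun t => f t + g t) = avg f + avg g.
Proof. by rewrite /avg big_split mulrDl. Qed.

Lemma avgZ T (c : R) (f : T -> R) : avg (fun t => c * f t) = c * avg f.
Proof. by rewrite /avg -mulr_sumr mulrA. Qed.

Lemma avg_sum T (I : Type) (r : seq I) (P : pred I) (f : I -> T -> R) :
  avg (fun t => \sum_(i <- r | P i) f i t) = \sum_(i <- r | P i) avg (f i).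
Proof. by rewrite /avg exchange_big mulr_suml. Qed.

Lemma ler_avg T (f g : T -> R) : (forall t, f t <= g t) -> avg f <= avg g.
Proof. by move=> fg; rewrite /avg ler_wpM2r ?invr_ge0 ?ler0n// ler_sum. Qed.

Lemma avg_ge0 T (f : T -> R) : (forall t, 0 <= f t) -> 0 <= avg f.
Proof. by move=> f0; rewrite divr_ge0 ?ler0n// sumr_ge0. Qed.

Lemma avg_cst T (c : R) : (0 < #|T|)%N -> avg (fun _ : T => c) = c.
Proof.
move=> T0; rewrite /avg sumr_const -[X in X / _]mulr_natr mulfK//.
by rewrite pnatr_eq0 -lt0n.
Qed.

Lemma ler_norm_avg T (f : T -> R) : `|avg f| <= avg (fun t => `|f t|).
Proof.
rewrite /avg normrM normfV normr_nat.
by rewrite ler_wpM2r ?invr_ge0 ?ler0n// ler_norm_sum.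
Qed.

Lemma avg_pair S T (f : S * T -> R) :
  avg f = avg (fun s => avg (fun t => f (s, t))).
Proof.
rewrite /avg -mulr_suml pair_big card_prod natrM invfM [X in _ * X]mulrC mulrA.
by congr (_ / _ / _); apply: eq_bigr => -[].
Qed.

Lemma avg_prod S T (f : S -> R) (g : T -> R) :
  avg (fun st : S * T => f st.1 * g st.2) = avg f * avg g.
Proof.
rewrite avg_pair /= mulrC -avgZ; apply: eq_avg => s.
by rewrite avgZ mulrC.
Qed.

Lemma exists_le_avg T (f : T -> R) : (0 < #|T|)%N -> exists t, f t <= avg f.
Proof.
move=> T0; case: (boolP [exists t, f t <= avg f]) => [/existsP//|].
rewrite negb_exists => /forallP h.
have [t0 _] : exists t0 : T, t0 \in T by apply/card_gt0P.
have : \sum_(t : T) avg f < \sum_t f t.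
  apply: ltr_sum => [|t _]; last by rewrite ltNge.
  by apply/hasP; exists t0; rewrite ?mem_index_enum.
rewrite sumr_const -mulr_natr /avg divfK ?ltxx//.
by rewrite pnatr_eq0 -lt0n.
Qed.

(* Pointwise, [f t <= tau + f t ^+ k.+1 / tau ^+ k]. *)
Lemma avg_le_of_exp T (f : T -> R) (k : nat) (tau : R) :
    (0 < #|T|)%N -> 0 < tau -> (forall t, 0 <= f t) ->
  avg f <= tau + avg (fun t => f t ^+ k.+1) / tau ^+ k.
Proof.
move=> T0 tau0 f0; rewrite -[X in X + _](avg_cst tau T0) mulrC -avgZ -avgD.
apply: ler_avg => t.
have tk : 0 < tau ^+ k by rewrite exprn_gt0.
have [ft|ft] := leP (f t) tau.
  by rewrite ler_wpDr// mulr_ge0 ?invr_ge0 ?exprn_ge0// ltW.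
apply: ler_wpDl; first exact: ltW.
rewrite ler_pdivlMl// exprSr ler_wpM2r//.
by rewrite lerXn2r// ?nnegrE// ltW.
Qed.

(** The uniform measure on [S] is pushed forward to the uniform one on [T]; written without division
    so as to be an equation in [nat]. *)
Definition balanced S T (phi : S -> T) :=
  forall t, (#|[set s | phi s == t]| * #|T| = #|S|)%N.

Lemma avg_balanced S T (phi : S -> T) (g : T -> R) :
  (0 < #|S|)%N -> balanced phi -> avg (fun s => g (phi s)) = avg g.
Proof.
move=> S0 bphi; rewrite /avg.
have T0 : (#|T|%:R : R) != 0.
  have /card_gt0P[s _] := S0; move: S0; rewrite -(bphi (phi s)) pnatr_eq0.
  by case: (#|T|) => //; rewrite muln0.
have S0' : (#|S|%:R : R) != 0 by rewrite pnatr_eq0 -lt0n.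
rewrite (partition_big phi predT)//= mulr_suml mulr_suml; apply: eq_bigr => t _.
rewrite (eq_bigr (fun=> g t)) => [|s /eqP->//].
have e : #|S|%:R = #|[set s | phi s == t]|%:R * #|T|%:R :> R.
  by rewrite -natrM bphi.
move: S0'; rewrite e mulf_eq0 negb_or => /andP[F0 _].
rewrite sumr_const -(cardsE (fun s => phi s == t)) -[X in X / _]mulr_natr.
by field; rewrite T0.
Qed.

End Averages.

(** * Marginals of a uniformly random map J -> V *)

Section Marginals.
Variables (V J : finType).
Hypothesis V0 : (0 < #|V|)%N.

(** Prescribing the values on a duplicate-free list leaves the other coordinates free. The marginal
    lemmas below are instances, with [u] holding the prescribed values. *)
Lemma card_ffun_fixed (s : seq J) (u : J -> V) : uniq s ->
  (#|[set v : {ffun J -> V} | all (fun j => v j == u j) s]| * #|V| ^ size s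
   = #|V| ^ #|J|)%N.
Proof.
move=> us.
pose F (j : J) : pred V := if j \in s then pred1 (u j) else predT.
have -> : #|[set v : {ffun J -> V} | all (fun j => v j == u j) s]|
    = #|(family F : pred {ffun J -> V})|.
  apply: eq_card => v; rewrite inE; apply/allP/familyP => [h j|h j js].
    by rewrite /F; case: ifP => // js; rewrite inE; apply: h.
  by have := h j; rewrite /F js inE.
rewrite card_family foldrE big_map big_enum /=.
rewrite (bigID (mem s))/= big1 => [|j js]; last by rewrite /F js card1.
rewrite mul1n (eq_bigr (fun=> #|V|)) => [|j /negbTE js]; last by rewrite /F js.
rewrite prod_nat_const -expnD; congr (_ ^ _)%N.
by rewrite -(card_uniqP us) addnC -(cardC (mem s)).
Qed.

Lemma card_ffun_gt0 : (0 < #|{ffun J -> V}|)%N.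
Proof. by rewrite card_ffun expn_gt0 V0. Qed.

Lemma balanced_comp (I : finType) (phi : I -> J) : injective phi ->
  balanced (fun v : {ffun J -> V} => [ffun i => v (phi i)] : {ffun I -> V}).
Proof.
move=> iphi f; have /card_gt0P[x0 _] := V0.
pose u j := if [pick i | phi i == j] is Some i then f i else x0.
have uE i : u (phi i) = f i.
  rewrite /u; case: pickP => [i' /eqP e|/(_ i)]; last by rewrite eqxx.
  by rewrite (iphi _ _ e).
have := @card_ffun_fixed [seq phi i | i <- enum I] u.
rewrite map_inj_uniq// enum_uniq => /(_ isT).
rewrite size_map -cardE !card_ffun => <-; congr (_ * _)%N.
apply: eq_card => v; rewrite !inE all_map; apply/eqP/allP => [vf i _|h].
  by rewrite /= uE -vf ffunE.
by apply/ffunP => i; rewrite ffunE -uE; apply/eqP/h; rewrite mem_enum.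
Qed.

Lemma balanced1 (a : J) : balanced (fun v : {ffun J -> V} => v a).
Proof.
move=> x; rewrite card_ffun -(@card_ffun_fixed [:: a] (fun=> x) isT) /= expn1.
by congr (_ * _)%N; apply: eq_card => v; rewrite !inE andbT.
Qed.

Lemma balanced2 (a b : J) : uniq [:: a; b] ->
  balanced (fun v : {ffun J -> V} => (v a, v b)).
Proof.
move=> us [x y]; rewrite card_ffun -(card_ffun_fixed (fun j =>
  if j == a then x else y) us) /=.
rewrite !card_prod !expnS expn0 muln1; congr (_ * _)%N.
apply: eq_card => v; rewrite !inE /= !xpair_eqE eqxx.
by move: us; rewrite /= !inE [b == a]eq_sym; case: (a == b) => //; rewrite !andbT.
Qed.

Lemma balanced3 (a b c : J) : uniq [:: a; b; c] ->
  balanced (fun v : {ffun J -> V} => (v a, v b, v c)).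
Proof.
move=> us [[x y] z]; rewrite card_ffun -(card_ffun_fixed (fun j =>
  if j == a then x else if j == b then y else z) us) /=.
rewrite !card_prod !expnS expn0 muln1 ?mulnA; congr (_ * _ * _ * _)%N.
apply: eq_card => v; rewrite !inE /= !xpair_eqE !eqxx.
move: us; rewrite /= !inE !negb_or -!andbA => /and4P[ab ac bc _].
by rewrite ![_ == a]eq_sym [c == b]eq_sym !(negbTE ab, negbTE ac, negbTE bc) !andbT ?andbA.
Qed.

Lemma balanced4 (a b c d : J) : uniq [:: a; b; c; d] ->
  balanced (fun v : {ffun J -> V} => ((v a, v b), (v c, v d))).
Proof.
move=> us [[x y] [z t]]; rewrite card_ffun -(card_ffun_fixed (fun j =>
  if j == a then x else if j == b then y else if j == c then z else t) us) /=.
rewrite !card_prod !expnS expn0 muln1 ?mulnA; congr (_ * _ * _ * _ * _)%N.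
apply: eq_card => v; rewrite !inE /= !xpair_eqE !eqxx.
move: us; rewrite /= !inE !negb_or -!andbA => /and5P[ab ac ad bc /and3P[bd cd _]].
rewrite [b == a]eq_sym [c == a]eq_sym [d == a]eq_sym [c == b]eq_sym [d == b]eq_sym [d == c]eq_sym.
by rewrite !(negbTE ab, negbTE ac, negbTE ad, negbTE bc, negbTE bd, negbTE cd) !andbT -?andbA.
Qed.

(** Restricting a uniform map along an injection gives a uniform map, so a copy of H with some
    vertices resampled is distributed like the original one. *)
Lemma avg_ffun_comp (R : realFieldType) (I : finType) (phi : I -> J)
    (g : {ffun I -> V} -> R) : injective phi ->
  avg (fun v : {ffun J -> V} => g [ffun i => v (phi i)]) = avg g.
Proof. by move=> /balanced_comp; apply: avg_balanced card_ffun_gt0. Qed.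

Lemma avg_ffun1 (R : realFieldType) (a : J) (g : V -> R) :
  avg (fun v : {ffun J -> V} => g (v a)) = avg g.
Proof. exact: avg_balanced card_ffun_gt0 (@balanced1 a). Qed.

Lemma avg_ffun2 (R : realFieldType) (a b : J) (g : V * V -> R) :
  uniq [:: a; b] -> avg (fun v : {ffun J -> V} => g (v a, v b)) = avg g.
Proof. by move=> /(@balanced2 a b); apply: avg_balanced card_ffun_gt0. Qed.

Lemma avg_ffun3 (R : realFieldType) (a b c : J) (g : V * V * V -> R) :
  uniq [:: a; b; c] ->
  avg (fun v : {ffun J -> V} => g (v a, v b, v c)) = avg g.
Proof. by move=> /(@balanced3 a b c); apply: avg_balanced card_ffun_gt0. Qed.

Lemma avg_ffun4 (R : realFieldType) (a b c d : J)
    (g : (V * V) * (V * V) -> R) : uniq [:: a; b; c; d] ->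
  avg (fun v : {ffun J -> V} => g ((v a, v b), (v c, v d))) = avg g.
Proof. by move=> /(@balanced4 a b c d); apply: avg_balanced card_ffun_gt0. Qed.

Lemma balanced6 (a b c d e f : J) : uniq [:: a; b; c; d; e; f] ->
  balanced (fun v : {ffun J -> V} => ((v a, v b, v c), (v d, v e, v f))).
Proof.
move=> us [[[x y] z] [[t q] r]]; rewrite card_ffun -(card_ffun_fixed (fun j =>
  if j == a then x else if j == b then y else if j == c then z else
  if j == d then t else if j == e then q else r) us) /=.
rewrite !card_prod !expnS expn0 muln1 ?mulnA; congr (_ * _ * _ * _ * _ * _ * _)%N.
apply: eq_card => v; rewrite !inE /= !xpair_eqE !eqxx.
(* Uniqueness of the reversed list gives the fifteen inequalities oriented as in the nested
   conditionals. *)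
have := us; rewrite -rev_uniq /= !inE !negb_or -!andbA.
do 15![case/andP=> /negbTE-> ] => _.
by rewrite !andbT -?andbA.
Qed.

Lemma avg_ffun6 (R : realFieldType) (a b c d e f : J)
    (g : (V * V * V) * (V * V * V) -> R) : uniq [:: a; b; c; d; e; f] ->
  avg (fun v : {ffun J -> V} => g ((v a, v b, v c), (v d, v e, v f))) = avg g.
Proof. by move=> /(@balanced6 a b c d e f); apply: avg_balanced card_ffun_gt0. Qed.

End Marginals.

(** * Resampling two vertices *)

Lemma prod_itv01 (R : realFieldType) (I : Type) (r : seq I) (P : pred I)
    (f : I -> R) :
  (forall i, 0 <= f i <= 1) -> 0 <= \prod_(i <- r | P i) f i <= 1.
Proof.
move=> f01; elim/big_ind: _ => [|x y /andP[x0 x1] /andP[y0 y1]|i _] //.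
- by rewrite ler01 lexx.
- by rewrite mulr_ge0// mulr_ile1.
Qed.

Lemma ler_norm_prodB (R : realFieldType) (I : Type) (r : seq I) (P : pred I)
    (f g : I -> R) :
  (forall i, 0 <= f i <= 1) -> (forall i, 0 <= g i <= 1) ->
  `|\prod_(i <- r | P i) f i - \prod_(i <- r | P i) g i|
    <= \sum_(i <- r | P i) `|f i - g i|.
Proof.
move=> f01 g01; elim: r => [|i r IH]; first by rewrite !big_nil subrr normr0.
rewrite !big_cons; case: ifP => // _.
set F := \prod_(j <- r | P j) f j in IH *; set G := \prod_(j <- r | P j) g j in IH *.
have -> : f i * F - g i * G = (f i - g i) * F + g i * (F - G) by ring.
apply: le_trans (ler_normD _ _) _; rewrite !normrM lerD//.
  have /andP[F0 F1] : 0 <= F <= 1 by exact: prod_itv01.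
  by rewrite ler_piMr// ger0_norm.
have /andP[g0 g1] := g01 i.
by apply: le_trans IH; rewrite ler_piMl// ger0_norm.
Qed.

Lemma norm_convD (R : realFieldType) (p q x y : R) :
  0 <= p <= 1 -> 0 <= q <= 1 -> `|p * x + q * y| <= `|x| + `|y|.
Proof.
move=> /andP[p0 p1] /andP[q0 q1]; apply: le_trans (ler_normD _ _) _.
by rewrite !normrM (ger0_norm p0) (ger0_norm q0) lerD// ler_piMl.
Qed.

Section PairProducts.
Variables (R : realFieldType) (V : finType) (h : nat).

(** Each unordered pair enters once. The kernel may depend on the pair [e], so that kernels can be
    exchanged one pair at a time. *)
Definition pairprod (X : 'I_h * 'I_h -> V -> V -> R) (v : {ffun 'I_h -> V}) : R :=
  \prod_(e : 'I_h * 'I_h | (e.1 < e.2)%N) X e (v e.1) (v e.2).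

Hypothesis V0 : (0 < #|V|)%N.
Variables (X : 'I_h * 'I_h -> V -> V -> R) (d eta : R).
Hypothesis X01 : forall e x y, 0 <= X e x y <= 1.
Hypothesis d01 : 0 < d <= 1.
Hypothesis Xd : avg (fun v => `|pairprod X v - d|) <= eta.

Lemma pairprod01 v : 0 <= pairprod X v <= 1.
Proof. by apply: prod_itv01 => e. Qed.

(** The 2 x 2 minor of [f] on rows x, x' and columns z, z'. *)
Definition swap4 (f : V -> V -> R) (q : (V * V) * (V * V)) : R :=
  f q.1.1 q.2.1 * f q.1.2 q.2.2 - f q.1.2 q.2.1 * f q.1.1 q.2.2.

(* Copies of [H] through the four pairs of {x, x'} x {z, z'} placed at [i] and
   [k] share all other factors once the two diagonals are multiplied out. *)
Lemma avg_swap4 (i k : 'I_h) : (i < k)%N ->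
  avg (fun q => `|swap4 (X (i, k)) q|) <= 4 * eta / d ^+ 2.
Proof.
move=> ik; have nik : i != k by apply: contraTneq ik => ->; rewrite ltnn.
have /andP[d0 d1] := d01.
(* [None] is a second copy of the vertex i and [Some None] one of k; [phi b c] uses these copies
   according to [b] and [c]. *)
pose J : finType := option (option 'I_h).
pose phi (b c : bool) (j : 'I_h) : J :=
  if (j == i) && b then None else if (j == k) && c then Some None else Some (Some j).
have iphi b c : injective (phi b c).
  move=> j l; rewrite /phi.
  move/eqP: (nik) => nik'.
  case: (j =P i) => ?; case: (l =P i) => ?; case: (j =P k) => ?; case: (l =P k) => ?;
    by case: b; case: c => /=; congruence.
pose F b c (v : {ffun J -> V}) := pairprod X [ffun j => v (phi b c j)].
have Feta b c : avg (fun v => `|F b c v - d|) <= eta.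
  apply: le_trans Xd.
  by rewrite /F (avg_ffun_comp V0 (fun v => `|pairprod X v - d|) (@iphi b c)).
have F01 b c v : 0 <= F b c v <= 1 by apply: pairprod01.
have us : uniq [:: Some (Some i); None; Some (Some k); Some None : J].
  by rewrite /= !inE !(inj_eq Some_inj)//= (negbTE nik).
rewrite -(avg_ffun4 V0 _ us).
pose f := X (i, k).
pose P (v : {ffun J -> V}) := f (v (Some (Some i))) (v (Some (Some k))) * f (v None) (v (Some None)).
pose Q (v : {ffun J -> V}) := f (v None) (v (Some (Some k))) * f (v (Some (Some i))) (v (Some None)).
have f01 x y : 0 <= f x y <= 1 by exact: X01.
have PQ v : d ^+ 2 * `|P v - Q v| <=
    `|F false false v - d| + `|F true true v - d| + (`|F true false v - d| + `|F false true v - d|).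
  pose ph b c e := X e (v (phi b c e.1)) (v (phi b c e.2)).
  pose M := \prod_(e : 'I_h * 'I_h | (e.1 < e.2)%N && (e != (i, k))) (ph false false e * ph true true e).
  (* A pair other than (i, k) meets at most one of i and k, so both diagonals supply it with the
     same two factors. *)
  have M' : \prod_(e : 'I_h * 'I_h | (e.1 < e.2)%N && (e != (i, k))) (ph true false e * ph false true e) = M.
    apply: eq_bigr => -[a b] /= /andP[ab]; rewrite xpair_eqE /ph /phi /=.
    case: (eqVneq a i) => [->|ai]; case: (eqVneq a k) => [ak|ak];
    case: (eqVneq b i) => [bi|bi]; case: (eqVneq b k) => [bk|bk] //= _;
      rewrite ?andbF ?andbT /= ?ak ?bi ?bk ?(negbTE nik) ?[k == i]eq_sym ?(negbTE nik) //;
      try exact: mulrC; try (by move: ab ik; rewrite ?ak ?bi ?bk; lia);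
      by move: nik; rewrite -bi -bk eqxx.
  have FE b c : F b c v = ph b c (i, k) * \prod_(e : 'I_h * 'I_h | (e.1 < e.2)%N && (e != (i, k))) ph b c e.
    rewrite /F /pairprod (bigD1 (i, k))//=; congr (_ * _); first by rewrite !ffunE.
    by apply: eq_bigr => e _; rewrite !ffunE.
  have F1 : F false false v * F true true v = P v * M.
    rewrite !FE mulrACA -big_split; congr (_ * _).
    by rewrite /P /ph /phi /= !eqxx [k == i]eq_sym (negbTE nik) ?andbF.
  have F2 : F true false v * F false true v = Q v * M.
    rewrite !FE mulrACA -big_split M'; congr (_ * _).
    by rewrite /Q /ph /phi /= !eqxx [k == i]eq_sym (negbTE nik) ?andbF.
  have P01 : 0 <= P v <= 1.
    move: (f01 (v (Some (Some i))) (v (Some (Some k)))) (f01 (v None) (v (Some None))).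
    by move=> /andP[? ?] /andP[? ?]; rewrite mulr_ge0// mulr_ile1.
  have Q01 : 0 <= Q v <= 1.
    move: (f01 (v None) (v (Some (Some k)))) (f01 (v (Some (Some i))) (v (Some None))).
    by move=> /andP[? ?] /andP[? ?]; rewrite mulr_ge0// mulr_ile1.
  have sq a b : 0 <= a <= 1 -> `|d ^+ 2 - a * b| <= `|a - d| + `|b - d|.
    move=> /andP[a0 a1].
    have -> : d ^+ 2 - a * b = d * (d - a) + a * (d - b) by ring.
    by rewrite [`|a - d|]distrC [`|b - d|]distrC norm_convD// ?a0 ?(ltW d0).
  rewrite -[X in X * _]ger0_norm ?exprn_ge0 ?(ltW d0)// -normrM.
  (* [M] may be small, so it is not cancelled: P M and Q M are each close to d^2, and the weights P
     and Q lie in [0, 1]. *)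
  have -> : d ^+ 2 * (P v - Q v) = Q v * (P v * M - d ^+ 2) + P v * (d ^+ 2 - Q v * M) by ring.
  apply: le_trans (norm_convD _ _ Q01 P01) _.
  by rewrite -F1 -F2 distrC lerD// sq// F01.
have := ler_avg PQ; rewrite avgZ !avgD ler_pdivlMr ?exprn_gt0// mulrC.
have := (Feta false false, Feta true true, Feta true false, Feta false true).
move=> [[[? ?] ?] ?] h1; apply: le_trans h1 _; lra.
Qed.

End PairProducts.

(** * Kernels with constant induced density are nearly constant *)

Section NearlyConstant.
Variables (R : realFieldType) (V : finType).
Hypothesis V0 : (0 < #|V|)%N.
Implicit Types w : V -> V -> R.

Definition row_gap w (t : V * V * V) : R := `|w t.1.1 t.1.2 - w t.1.1 t.2|.

Definition cross_gap w (q : (V * V) * (V * V)) : R :=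
  (w q.1.1 q.2.1 - w q.1.2 q.2.1) * (w q.1.1 q.2.1 - w q.1.1 q.2.2).

(** If the minors of w and of 1 - w both vanish, the two diagonals of the square have equal product
    and equal sum, hence the same two entries, and one of the two differences is 0. The identity in
    the proof is the quantitative form of this. *)
Lemma avg_cross_gap w (kappa : R) :
    (forall x y, 0 <= w x y <= 1) ->
    avg (fun q => `|swap4 w q|) <= kappa ->
    avg (fun q => `|swap4 (fun x y => 1 - w x y) q|) <= kappa ->
  avg (fun q => `|cross_gap w q|) <= 3 * kappa.
Proof.
move=> w01 h1 h2.
suff : avg (fun q => `|cross_gap w q|) <= 2 * avg (fun q => `|swap4 w q|)
    + avg (fun q => `|swap4 (fun x y => 1 - w x y) q|) by lra.
rewrite -avgZ -avgD; apply: ler_avg => -[[x x'] [z z']].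
rewrite /cross_gap /swap4 /=.
set a := w x z; set b := w x' z'; set c := w x' z; set d := w x z'.
set s := a * b - c * d; set s' := (1 - a) * _ - _.
have -> : (a - c) * (a - d) = - (1 - a) * s - a * s' by rewrite /s /s'; ring.
have /andP[a0 a1] : 0 <= a <= 1 by exact: w01.
apply: le_trans (ler_normB _ _) _; rewrite !normrM normrN.
rewrite (ger0_norm a0) (@ger0_norm _ (1 - a)) ?subr_ge0//.
by apply: lerD; [rewrite ler_wpM2r//; lra | rewrite ler_piMl].
Qed.

(* For points x, z, z', y, u, u': if w(x,z) <> w(x,z') and w(y,u) <> w(y,u'),
   vanishing cross gaps give w(u,z) = w(x,z) = w(u',z) and then
   w(y,u) = w(z,u) = w(z,u') = w(y,u'), a contradiction. *)
Lemma row_gap_mul w (kappa : R) :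
    (forall x y, w x y = w y x) -> (forall x y, 0 <= w x y <= 1) ->
    avg (fun q => `|cross_gap w q|) <= kappa ->
  avg (row_gap w) * avg (fun t => row_gap w t ^+ 2) <= 4 * kappa.
Proof.
move=> wC w01 hk; rewrite -avg_prod.
pose o k : 'I_6 := inord k.
have us : uniq [seq o k | k <- iota 0 6].
  by rewrite map_inj_in_uniq ?iota_uniq// => i j; rewrite !mem_iota => ? ? /(congr1 val); rewrite /= !inordK.
rewrite -(avg_ffun6 V0 _ us).
have hk4 a b c d : uniq [:: o a; o b; o c; o d] ->
    avg (fun v : {ffun 'I_6 -> V} => `|cross_gap w ((v (o a), v (o b)), (v (o c), v (o d)))|) <= kappa.
  by move=> u4; rewrite (avg_ffun4 V0 (fun q => `|cross_gap w q|) u4).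
have oE i j : (i < 6)%N -> (j < 6)%N -> (o i == o j) = (i == j).
  by move=> ? ?; rewrite -val_eqE /= !inordK.
(* The labels 0 to 5 stand for x, z, z', y, u, u'. The first two quadruples compare y with z at u,
   u'; the last two compare x with u and with u' at z, z'. *)
have H1 := hk4 3%N 1%N 4%N 5%N _; have H2 := hk4 3%N 1%N 5%N 4%N _.
have H3 := hk4 0%N 4%N 1%N 2%N _; have H4 := hk4 0%N 5%N 1%N 2%N _.
rewrite /= !inE !oE// in H1 H2 H3 H4.
move: (H1 isT) (H2 isT) (H3 isT) (H4 isT) => {}H1 {}H2 {}H3 {}H4.
apply: le_trans (_ : kappa + kappa + kappa + kappa <= _); last by lra.
apply: le_trans (lerD (lerD (lerD H1 H2) H3) H4); rewrite -!avgD.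
apply: ler_avg => v; rewrite /row_gap /cross_gap /= !normrM.
move: (v (o 0%N)) (v (o 1%N)) (v (o 2%N)) (v (o 3%N)) (v (o 4%N)) (v (o 5%N)) => x z z' y u u'.
rewrite (wC u z) (wC u' z).
have t1 : `|w y u - w y u'| <= `|w y u - w z u| + `|w z u - w z u'| + `|w y u' - w z u'|.
  have -> : w y u - w y u' = (w y u - w z u) + (w z u - w z u') - (w y u' - w z u') by ring.
  by apply: le_trans (ler_normB _ _) _; rewrite lerD2r ler_normD.
have t2 : `|w z u - w z u'| <= `|w x z - w z u| + `|w x z - w z u'|.
  have -> : w z u - w z u' = (w x z - w z u') - (w x z - w z u) by ring.
  by apply: le_trans (ler_normB _ _) _; rewrite addrC.
have le1 a b c d : `|w a b - w c d| <= 1.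
  by have := (w01 a b, w01 c d); rewrite ler_norml => -[/andP[? ?] /andP[? ?]]; lra.
have D1 := le1 x z x z'; have D2 := le1 y u y u'.
rewrite [`|w y u' - w y u|]distrC.
move: t1 t2 D1 D2; move: (normr_ge0 (w x z - w x z')) (normr_ge0 (w y u - w y u')).
move: (normr_ge0 (w y u - w z u)) (normr_ge0 (w y u' - w z u')) (normr_ge0 (w z u - w z u')).
move: `|_ - _| `|_ - _| `|_ - _| `|_ - _| `|_ - _| `|_ - _| `|_ - _|.
move=> S2 S1 D' D B C A A0 C0 B0 D0 D'0 t1 t2 D1 D'1.
(* One factor D' is split by the triangle inequality. The other completes [A] and [C] to cross gaps,
   while D completes [B] through B <= S1 + S2. *)
have h1 : D * D' ^+ 2 <= D * D' * (A + B + C) by rewrite expr2 mulrA ler_wpM2l// mulr_ge0.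
have h2 : D * (D' * A) <= D' * A by rewrite ler_piMl// mulr_ge0.
have h3 : D * (D' * C) <= D' * C by rewrite ler_piMl// mulr_ge0.
have h4 : D' * (D * B) <= D * B by rewrite ler_piMl// mulr_ge0.
have h5 : D * B <= D * (S1 + S2) by rewrite ler_wpM2l.
lra.
Qed.

(** If the mean of the row gap exceeded tau, its second moment would exceed tau^2/4, and the product
    of the two would exceed tau^3/4; but [row_gap_mul] bounds it by tau^3/8. *)
Lemma avg_row_gap_small w (kappa tau : R) :
    (forall x y, w x y = w y x) -> (forall x y, 0 <= w x y <= 1) -> 0 < tau ->
    avg (fun q => `|cross_gap w q|) <= kappa -> 32 * kappa <= tau ^+ 3 ->
  avg (row_gap w) <= tau.
Proof.
move=> wC w01 tau0 hk kt; have := row_gap_mul wC w01 hk.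
have V30 : (0 < #|{: V * V * V}|)%N by rewrite !card_prod !muln_gt0 V0.
have := @avg_le_of_exp R _ (row_gap w) 1 (tau / 2) V30.
rewrite divr_gt0// => /(_ isT (fun=> normr_ge0 _)).
rewrite expr1; set T := avg _; set T2 := avg _ => h1 h2.
rewrite leNgt; apply/negP => Tt.
have h3 : tau ^+ 2 / 4 < T2.
  move: h1; rewrite -lerBlDl => /(lt_le_trans (_ : tau / 2 < T - tau / 2)).
  by rewrite ltr_pdivlMr ?divr_gt0// => h1; have := h1 ltac:(lra); lra.
have h4 : tau * (tau ^+ 2 / 4) < T * T2.
  by rewrite ltr_pM// ?divr_ge0 ?exprn_ge0// ltW.
have : tau * (tau ^+ 2 / 4) = tau ^+ 3 / 4 by rewrite mulrA -exprS.
have : 0 < tau ^+ 3 by rewrite exprn_gt0.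
lra.
Qed.

(** For a >= b >= 0 this is the superadditivity (a - b)^k + b^k <= a^k. It leads back from powers of
    kernel values to the values. *)
Lemma ler_distX (m : nat) (a b : R) : 0 <= a -> 0 <= b ->
  `|a - b| ^+ m.+1 <= `|a ^+ m.+1 - b ^+ m.+1|.
Proof.
wlog ba : a b / b <= a => [hw a0 b0|a0 b0].
  have [ba|/ltW ab] := leP b a; first exact: hw.
  by rewrite distrC (distrC (a ^+ _)) hw.
rewrite ger0_norm ?subr_ge0// ger0_norm ?subr_ge0; last by rewrite lerXn2r.
rewrite lerBrDr; elim: m => [|m IH]; first by rewrite !expr1 subrK.
have d0 : 0 <= a - b by rewrite subr_ge0.
rewrite !(exprS _ m.+1).
have -> : a * a ^+ m.+1 = (a - b) * a ^+ m.+1 + b * a ^+ m.+1 by ring.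
by apply: lerD; rewrite ler_wpM2l// lerXn2r// lerBlDr lerDl.
Qed.

(** All factors are [w], so only minors of [w] are controlled. Let x and x' be two choices of vertex
    0 and y a further point. The minors give w(x,y) w(x',z_k) ~ w(x',y) w(x,z_k); multiplying over
    the h - 1 values of k, and by the factors without vertex 0, compares w(x,y)^(h-1) d with
    w(x',y)^(h-1) d. *)
Lemma avg_row_gap_clique (h : nat) w (d eta : R) :
    (2 <= h)%N -> (forall x y, w x y = w y x) -> (forall x y, 0 <= w x y <= 1) ->
    0 < d <= 1 ->
    avg (fun v => `|pairprod (fun _ : 'I_h * 'I_h => w) v - d|) <= eta ->
  d * avg (fun t => row_gap w t ^+ h.-1) <= 2 * eta + h%:R * (4 * eta / d ^+ 2).
Proof.
move=> h2 wC w01 /andP[d0 d1] hd.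
pose i0 : 'I_h := Ordinal (ltnW h2).
have i0lt (k : 'I_h) : (i0 < k)%N = (k != i0) by rewrite lt0n.
have hswap k : k != i0 -> avg (fun q => `|swap4 w q|) <= 4 * eta / d ^+ 2.
  rewrite -i0lt => ik.
  by apply: (@avg_swap4 R V h V0 (fun=> w) d eta (fun=> w01) _ hd i0 k ik); rewrite d0.
(* [None] is the second choice x' of vertex 0 and [Some None] the extra point y. *)
pose J : finType := option (option 'I_h).
pose S (j : 'I_h) : J := Some (Some j).
pose phi (b : bool) (j : 'I_h) : J := if (j == i0) && b then None else S j.
have iphi b : injective (phi b).
  by move=> j l; rewrite /phi; case: (j =P i0) => ?; case: (l =P i0) => ?; case: b => /=; rewrite /S; congruence.
pose F b (v : {ffun J -> V}) := pairprod (fun=> w) [ffun j => v (phi b j)].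
have Feta b : avg (fun v => `|F b v - d|) <= eta.
  by apply: le_trans hd; rewrite /F (avg_ffun_comp V0 (fun v => `|pairprod _ v - d|) (@iphi b)).
have us3 : uniq [:: Some None; S i0; None : J] by [].
rewrite -(avg_ffun3 V0 _ us3).
pose D k (v : {ffun J -> V}) : R := `|swap4 w ((v (S i0), v None), (v (Some None), v (S k)))|.
have Davg k : k != i0 -> avg (D k) <= 4 * eta / d ^+ 2.
  move=> ki; apply: le_trans (hswap _ ki).
  rewrite /D (avg_ffun4 V0 (fun q => `|swap4 w q|))//= !inE andbT !negb_or.
  by rewrite /S !(inj_eq Some_inj) [i0 == k]eq_sym /= ki.
have key (v : {ffun J -> V}) : d * row_gap w (v (Some None), v (S i0), v None) ^+ h.-1 <=
    `|F false v - d| + `|F true v - d| + \sum_(k | k != i0) D k v.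
  pose z j := v (S j).
  pose x b := v (phi b i0).
  pose C := \prod_(a | a != i0) \prod_(b : 'I_h | (a < b)%N) w (z a) (z b).
  have FE b : F b v = \prod_(k | k != i0) w (x b) (z k) * C.
    rewrite /F /pairprod.
    rewrite -(pair_big_dep predT (fun a b : 'I_h => (a < b)%N) (fun i j => w ([ffun j => v (phi b j)] i) ([ffun j => v (phi b j)] j))) /=.
    rewrite (bigD1 i0)//=; congr (_ * _).
      apply: eq_big => k; first by rewrite i0lt.
      by rewrite i0lt => ki; rewrite !ffunE /x {2}/phi (negbTE ki).
    apply: eq_bigr => a ai; apply: eq_bigr => c ac; rewrite !ffunE /phi (negbTE ai).
    by rewrite (_ : c == i0 = false)//; apply: contraTF ac => /eqP->.
  set y := v (Some None).
  set m := h.-1.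
  have card_m : #|[pred k : 'I_h | k != i0]| = m.
    by rewrite /m -[in RHS](card_ord h) -(cardC1 i0); apply: eq_card => k.
  have pow c : c ^+ m = \prod_(k : 'I_h | k != i0) c :> R.
    by rewrite prodr_const card_m.
  have x01 b k : 0 <= w (x b) (z k) <= 1 by [].
  pose X b := \prod_(k | k != i0) w (x b) (z k).
  have X01 b : 0 <= X b <= 1 by apply: prod_itv01.
  have C01 : 0 <= C <= 1 by apply: prod_itv01 => a; apply: prod_itv01.
  have p01 b : 0 <= w (x b) y ^+ m <= 1.
    by have /andP[? ?] := w01 (x b) y; rewrite exprn_ge0// exprn_ile1.
  have hX : `|w (x false) y ^+ m * X true - w (x true) y ^+ m * X false| <= \sum_(k | k != i0) D k v.
    rewrite !pow -!big_split; apply: ler_norm_prodB => k.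
      have /andP[? ?] := w01 (x false) y; have /andP[? ?] := x01 true k.
      by rewrite mulr_ge0// mulr_ile1.
    have /andP[? ?] := w01 (x true) y; have /andP[? ?] := x01 false k.
    by rewrite mulr_ge0// mulr_ile1.
  have -> : row_gap w (y, v (S i0), v None) = `|w (x false) y - w (x true) y|.
    by rewrite /row_gap /x /phi /= ?eqxx /= !(wC y).
  have hm : m = m.-1.+1 by rewrite /m -[h in RHS](prednK (ltnW h2)) /= prednK// -subn1 subn_gt0.
  have /andP[? _] := w01 (x false) y; have /andP[? _] := w01 (x true) y.
  apply: le_trans (_ : d * `|w (x false) y ^+ m - w (x true) y ^+ m| <= _).
    by rewrite ler_wpM2l ?(ltW d0)// hm ler_distX.
  rewrite -{1}(gtr0_norm d0) -normrM.
  have -> : d * (w (x false) y ^+ m - w (x true) y ^+ m) =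
     - (w (x false) y ^+ m * (F true v - d) + - w (x true) y ^+ m * (F false v - d))
     + C * (w (x false) y ^+ m * X true - w (x true) y ^+ m * X false).
    by rewrite !FE -/(X true) -/(X false); ring.
  apply: le_trans (ler_normD _ _) _; rewrite normrN lerD//.
    apply: le_trans (ler_normD _ _) _; rewrite addrC mulNr normrN !normrM.
    have /andP[? ?] := p01 true; have /andP[? ?] := p01 false.
    by apply: lerD; rewrite ler_piMl// ger0_norm.
  apply: le_trans hX; have /andP[? ?] := C01.
  by rewrite normrM ler_piMl// ger0_norm.
apply: le_trans (_ : avg (fun v => `|F false v - d| + `|F true v - d| + \sum_(k | k != i0) D k v) <= _).
  by rewrite -avgZ; apply: ler_avg.
rewrite !avgD; apply: lerD; first by have := (Feta true, Feta false); case; lra.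
rewrite avg_sum; apply: le_trans (_ : \sum_(k : 'I_h | k != i0) (4 * eta / d ^+ 2) <= _).
  by apply: ler_sum.
have e0 : 0 <= 4 * eta / d ^+ 2.
  rewrite divr_ge0 ?exprn_ge0 ?(ltW d0)// mulr_ge0//; apply: le_trans hd.
  by apply: avg_ge0.
rewrite [X in _ <= X](_ : _ = \sum_(k : 'I_h) (4 * eta / d ^+ 2)).
  by rewrite big_mkcond; apply: ler_sum => k _; case: ifP.
by rewrite sumr_const card_ord -[RHS]mulr_natl.
Qed.

(** Two row changes join any two pairs: by symmetry |w(z,t) - w(x,y)| <= |w(z,t) - w(z,y)| + |w(y,z)
    - w(y,x)|. Some pair (x, y) does no worse than the average, and its value serves as a. *)
Lemma exists_constant w (tau : R) :
    (forall x y, w x y = w y x) -> (forall x y, 0 <= w x y <= 1) ->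
    avg (row_gap w) <= tau ->
  exists2 a : R, 0 <= a <= 1 & avg (fun q : V * V => `|w q.1 q.2 - a|) <= 2 * tau.
Proof.
move=> wC w01 hw.
pose g (q : (V * V) * (V * V)) := `|w q.2.1 q.2.2 - w q.1.1 q.1.2|.
have hg : avg g <= 2 * tau.
  pose o k : 'I_4 := inord k.
  have oE i j : (i < 4)%N -> (j < 4)%N -> (o i == o j) = (i == j).
    by move=> ? ?; rewrite -val_eqE /= !inordK.
  rewrite -(avg_ffun4 V0 (a := o 0%N) (b := o 1%N) (c := o 2%N) (d := o 3%N)); last first.
    by rewrite /= !inE !oE.
  rewrite mulr_natl mulr2n; apply: le_trans (lerD hw hw).
  rewrite -{1}(avg_ffun3 V0 (a := o 2%N) (b := o 3%N) (c := o 1%N)); last first.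
    by rewrite /= !inE !oE.
  rewrite -(avg_ffun3 V0 (a := o 1%N) (b := o 2%N) (c := o 0%N)); last first.
    by rewrite /= !inE !oE.
  rewrite -avgD; apply: ler_avg => v; rewrite /g /row_gap /=.
  rewrite [w (v (o 0%N)) _]wC [w (v (o 1%N)) (v (o 2%N))]wC.
  exact: ler_distD.
have VV0 : (0 < #|{: V * V}|)%N by rewrite card_prod muln_gt0 V0.
rewrite avg_pair in hg.
have [[x y] hxy] := exists_le_avg (fun s => avg (fun t => g (s, t))) VV0.
by exists (w x y) => //; apply: le_trans hg.
Qed.

Definition kern (b : bool) (t : R) : R := if b then t else 1 - t.

Lemma kern01 b t : 0 <= t <= 1 -> 0 <= kern b t <= 1.
Proof. by case: b => //= /andP[t0 t1]; rewrite subr_ge0 t1 lerBlDr lerDl. Qed.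

Lemma kern_dist b t u : `|kern b t - kern b u| = `|t - u|.
Proof. by case: b => //=; rewrite [RHS]distrC; congr `|_|; ring. Qed.

Lemma avg_pairprod_dist (h : nat) (X Y : 'I_h * 'I_h -> V -> V -> R) (eps : R) :
    (forall e x y, 0 <= X e x y <= 1) -> (forall e x y, 0 <= Y e x y <= 1) ->
    (forall e, avg (fun q => `|X e q.1 q.2 - Y e q.1 q.2|) <= eps) ->
  avg (fun v => `|pairprod X v - pairprod Y v|) <= (h * h)%:R * eps.
Proof.
move=> X01 Y01 hXY.
apply: le_trans (_ : avg (fun v : {ffun 'I_h -> V} => \sum_(e : 'I_h * 'I_h | (e.1 < e.2)%N)
    `|X e (v e.1) (v e.2) - Y e (v e.1) (v e.2)|) <= _).
  by apply: ler_avg => v; apply: ler_norm_prodB.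
rewrite avg_sum.
apply: le_trans (_ : \sum_(e : 'I_h * 'I_h | (e.1 < e.2)%N) eps <= _).
  apply: ler_sum => -[i j] /= ij; apply: le_trans (hXY (i, j)).
  rewrite (avg_ffun2 V0 (fun q => `|X (i, j) q.1 q.2 - Y (i, j) q.1 q.2|))//=.
  by rewrite inE andbT; apply: contraTneq ij => ->; rewrite ltnn.
rewrite [X in _ <= X](_ : _ = \sum_(e : 'I_h * 'I_h) eps).
  have [e0|] := leP 0 eps.
    by rewrite big_mkcond; apply: ler_sum => k _; case: ifP.
  rewrite big_mkcond => e0; apply: ler_sum => e _; case: ifP => // _.
  by move: (le_lt_trans (hXY e) e0); rewrite ltNge avg_ge0.
by rewrite sumr_const card_prod card_ord -[RHS]mulr_natl.
Qed.

End NearlyConstant.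

Lemma nearly_constant (R : realFieldType) (h : nat) (b : 'I_h * 'I_h -> bool)
    (d kappa : R) :
    (2 <= h)%N -> 0 < d <= 1 -> 0 < kappa ->
  exists2 eta : R, 0 < eta &
    forall (V : finType) (w : V -> V -> R), (0 < #|V|)%N ->
      (forall x y, w x y = w y x) -> (forall x y, 0 <= w x y <= 1) ->
      avg (fun v => `|pairprod (fun e x y => kern (b e) (w x y)) v - d|) <= eta ->
    exists2 a : R, 0 <= a <= 1 &
      avg (fun q : V * V => `|w q.1 q.2 - a|) <= kappa /\
      `|\prod_(e : 'I_h * 'I_h | (e.1 < e.2)%N) kern (b e) a - d| <= kappa.
Proof.
move=> h2 d01 k0; have /andP[d0 d1] := d01.
have h0 : 0 < h%:R :> R by rewrite ltr0n ltnW.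
have hh0 : 0 < (h * h)%:R :> R by rewrite ltr0n muln_gt0 ltnW.
have hh1 : 1 <= (h * h)%:R :> R by rewrite ler1n muln_gt0 ltnW.
pose tau := kappa / (4 * (h * h)%:R).
have tau0 : 0 < tau by rewrite divr_gt0// mulr_gt0.
have tauk : 4 * ((h * h)%:R * tau) = kappa by rewrite /tau; field; rewrite gt_eqF.
pose c := 2 + h%:R * (4 / d ^+ 2).
have d20 : 0 < d ^+ 2 by rewrite exprn_gt0.
have c0 : 0 < c by rewrite addr_gt0// mulr_gt0// divr_gt0.
(* [eta1] covers half of the final comparison of densities, [eta2] makes the mean cross gap at most
   tau^3/32, and [eta3] makes the moment of order h - 1 of the row gap at most (tau/2)^(h-1). *)
pose eta1 := kappa / 2.
pose eta2 := tau ^+ 3 / 96 / (4 / d ^+ 2).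
pose eta3 := (tau / 2) * (tau / 2) ^+ h.-2 * d / c.
have e10 : 0 < eta1 by rewrite divr_gt0.
have e20 : 0 < eta2 by rewrite !divr_gt0// exprn_gt0.
have t20 : 0 < tau / 2 by rewrite divr_gt0.
have e30 : 0 < eta3 by rewrite /eta3 divr_gt0// mulr_gt0// mulr_gt0// exprn_gt0.
exists (Num.min eta1 (Num.min eta2 eta3)); first by rewrite !lt_min e10 e20.
move=> V w V0 wC w01 hw.
have {hw} [hw1 hw2 hw3] : [/\
    avg (fun v => `|pairprod (fun e x y => kern (b e) (w x y)) v - d|) <= eta1,
    avg (fun v => `|pairprod (fun e x y => kern (b e) (w x y)) v - d|) <= eta2 &
    avg (fun v => `|pairprod (fun e x y => kern (b e) (w x y)) v - d|) <= eta3].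
  by split; apply: le_trans hw _; rewrite !ge_min lexx ?orbT.
have X01 e x y : 0 <= kern (b e) (w x y) <= 1 by exact: kern01.
have V30 : (0 < #|{: V * V * V}|)%N by rewrite !card_prod !muln_gt0 V0.
have clique (u : V -> V -> R) : (forall x y, u x y = u y x) -> (forall x y, 0 <= u x y <= 1) ->
    avg (fun v => `|pairprod (fun _ : 'I_h * 'I_h => u) v - d|) <= eta3 -> avg (row_gap u) <= tau.
  move=> uC u01 hu; have := avg_row_gap_clique V0 h2 uC u01 d01 hu.
  have -> : 2 * eta3 + h%:R * (4 * eta3 / d ^+ 2) = c * eta3 by rewrite /c; ring.
  have -> : h.-1 = h.-2.+1 by case: (h) h2 => [|[]].
  rewrite [c * _]mulrC /eta3 divfK ?gt_eqF// mulrC ler_pM2r// => hT.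
  have := @avg_le_of_exp R _ (row_gap u) h.-2 (tau / 2) V30.
  rewrite divr_gt0// => /(_ isT (fun=> normr_ge0 _)) h1.
  apply: le_trans h1 _.
  have : avg (fun t => row_gap u t ^+ h.-2.+1) / (tau / 2) ^+ h.-2 <= tau / 2.
    rewrite ler_pdivrMr ?exprn_gt0//.
  lra.
have flat : avg (row_gap w) <= tau.
  have [/existsP[e1 /andP[ij1 be1]]|] := boolP [exists e : 'I_h * 'I_h, (e.1 < e.2)%N && b e]; last first.
    rewrite negb_exists => /forallP nb.
    (* An empty H is a complete one for 1 - w, and row gaps are the same for both kernels. *)
    have -> : avg (row_gap w) = avg (row_gap (fun x y => 1 - w x y)).
      apply: eq_avg => t; rewrite /row_gap distrC; congr `|_|; ring.
    apply: clique => [x y|x y|]; [by rewrite wC | by apply: (@kern01 _ false) |].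
    rewrite (_ : avg _ = avg (fun v => `|pairprod (fun e x y => kern (b e) (w x y)) v - d|))//.
    apply: eq_avg => v; congr `|_ - d|; apply: eq_bigr => e lte.
    by have := nb e; rewrite lte /= => /negbTE->.
  have [/existsP[e2 /andP[ij2 be2]]|] := boolP [exists e : 'I_h * 'I_h, (e.1 < e.2)%N && ~~ b e]; last first.
    rewrite negb_exists => /forallP nb; apply: clique => //.
    rewrite (_ : avg _ = avg (fun v => `|pairprod (fun e x y => kern (b e) (w x y)) v - d|))//.
    apply: eq_avg => v; congr `|_ - d|; apply: eq_bigr => e lte.
    by have := nb e; rewrite lte /= negbK => ->.
  have := avg_swap4 V0 X01 d01 hw2 ij1; have := avg_swap4 V0 X01 d01 hw2 ij2.
  rewrite -!surjective_pairing (negbTE be2) be1 /= => s2 s1.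
  apply: (avg_row_gap_small V0 wC w01 tau0 (avg_cross_gap w01 s1 s2)).
  have -> : 4 * eta2 / d ^+ 2 = eta2 * (4 / d ^+ 2) by ring.
  rewrite /eta2 divfK ?gt_eqF ?divr_gt0//; lra.
have [a a01 ha] := exists_constant V0 wC w01 flat.
have tk : 2 * tau <= kappa / 2.
  have : tau <= (h * h)%:R * tau by rewrite ler_peMl// ltW.
  lra.
exists a => //; split; first by apply: le_trans ha _; lra.
have W0 : (0 < #|{ffun 'I_h -> V}|)%N by apply: card_ffun_gt0.
have := @avg_pairprod_dist R V V0 h (fun e _ _ => kern (b e) a) (fun e x y => kern (b e) (w x y)) (2 * tau)
  (fun _ _ _ => kern01 _ a01) X01.
move=> /(_ (fun e => _)) h1.
rewrite -(avg_cst `|_ - d| W0).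
apply: le_trans (_ : (h * h)%:R * (2 * tau) + eta1 <= _); last by rewrite /eta1; lra.
apply: le_trans (lerD (h1 _) hw1).
  by rewrite -avgD; apply: ler_avg => v; apply: ler_distD.
move=> e; rewrite (_ : avg _ = avg (fun q : V * V => `|w q.1 q.2 - a|))//.
by apply: eq_avg => q; rewrite kern_dist distrC.
Qed.

(** * Regularity *)

Section ConditionalExpectation.
Variables (R : realFieldType) (Z : finType) (K : eqType) (key : Z -> K).

Definition cond_exp (f : Z -> R) (z : Z) : R :=
  (\sum_(z' | key z' == key z) f z') / #|[pred z' | key z' == key z]|%:R.

Lemma cond_exp_key f z z' : key z = key z' -> cond_exp f z = cond_exp f z'.
Proof. by rewrite /cond_exp => ->. Qed.

Lemma cond_exp_card_gt0 z : 0 < #|[pred z' | key z' == key z]|%:R :> R.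
Proof. by rewrite ltr0n; apply/card_gt0P; exists z; rewrite inE. Qed.

Lemma cond_exp01 f z : (forall z, 0 <= f z <= 1) -> 0 <= cond_exp f z <= 1.
Proof.
move=> f01; apply/andP; split.
  by rewrite divr_ge0 ?ler0n// sumr_ge0// => z' _; case/andP: (f01 z').
rewrite ler_pdivrMr ?cond_exp_card_gt0// mul1r -sumr_const.
by apply: ler_sum => z' _; case/andP: (f01 z').
Qed.

Lemma avg_cond_exp f g : (forall z z', key z = key z' -> g z = g z') ->
  avg (fun z => cond_exp f z * g z) = avg (fun z => f z * g z).
Proof.
move=> gkey; congr (_ / _).
under eq_bigr do rewrite /cond_exp -mulrA mulr_suml big_mkcond.
rewrite exchange_big; apply: eq_bigr => z _ /=; rewrite -big_mkcond /=.
rewrite (eq_bigr (fun=> f z * g z / #|[pred z' | key z' == key z]|%:R)).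
  rewrite sumr_const -[LHS]mulr_natr.
  rewrite (eq_card (B := [pred z' | key z' == key z])) => [|z'].
    by rewrite divfK// gt_eqF// cond_exp_card_gt0.
  by rewrite !inE eq_sym.
by move=> z' /eqP e; rewrite mulrA -e -[in LHS](gkey _ _ e) mulrAC.
Qed.
End ConditionalExpectation.

(** Pythagoras: for a finer [key'], the change of the conditional expectation is orthogonal to the
    coarser one. *)
Lemma avg_cond_exp_sqB (R : realFieldType) (Z : finType) (K K' : eqType)
    (key : Z -> K) (key' : Z -> K') (f : Z -> R) :
    (forall z z', key' z = key' z' -> key z = key z') ->
  avg (fun z => (cond_exp key' f z - cond_exp key f z) ^+ 2) =
  avg (fun z => cond_exp key' f z ^+ 2) - avg (fun z => cond_exp key f z ^+ 2).
Proof.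
move=> fine.
have e : avg (fun z => cond_exp key' f z * cond_exp key f z) = avg (fun z => cond_exp key f z ^+ 2).
  have ck z z' : key z = key z' -> cond_exp key f z = cond_exp key f z' by exact: cond_exp_key.
  rewrite (@avg_cond_exp _ _ _ key' f (cond_exp key f)) => [|z z' /fine]; last exact: ck.
  by rewrite -(@avg_cond_exp _ _ _ key f (cond_exp key f)).
apply/eqP; rewrite eq_sym subr_eq; apply/eqP.
have -> : avg (fun z => cond_exp key' f z ^+ 2) =
   avg (fun z => (cond_exp key' f z - cond_exp key f z) ^+ 2 + 2 * (cond_exp key' f z * cond_exp key f z)
     + -1 * cond_exp key f z ^+ 2).
  by apply: eq_avg => z; ring.
by rewrite !avgD !avgZ e; ring.
Qed.

Lemma sqr_avg_le (R : realFieldType) (T : finType) (f : T -> R) :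
  avg f ^+ 2 <= avg (fun t => f t ^+ 2).
Proof.
have [T0|] := posnP #|T|.
  by rewrite /avg T0 invr0 !mulr0 expr0n.
move=> T0; have : 0 <= avg (fun t => (f t - avg f) ^+ 2) by apply: avg_ge0 => t; apply: sqr_ge0.
have -> : avg (fun t => (f t - avg f) ^+ 2) = avg (fun t => f t ^+ 2 + (- 2 * avg f) * f t + avg f ^+ 2).
  by apply: eq_avg => t; ring.
by rewrite !avgD avgZ avg_cst//; lra.
Qed.

(** * Cut norm and energy increment *)

Section Regularity.
Variables (R : realType) (V : finType).
Implicit Types (s t : seq {set V}) (A D : V * V -> R).

(* The partition of [V] into the atoms generated by [s] is encoded by the bit
   vectors of memberships. *)
Definition atom s (x : V) : bitseq := [seq x \in U | U : {set V} <- s].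
Definition box s (q : V * V) := (atom s q.1, atom s q.2).
Definition smooth s A : V * V -> R := cond_exp (box s) A.
Definition energy s A : R := avg (fun q => smooth s A q ^+ 2).

Definition rect (S T : {set V}) (q : V * V) : R := ((q.1 \in S) && (q.2 \in T))%:R.

Definition cut_le (eps : R) D :=
  forall S T, `|avg (fun q => D q * rect S T q)| <= eps.

Lemma box_cat t s q q' : box (t ++ s) q = box (t ++ s) q' -> box s q = box s q'.
Proof.
rewrite /box /atom !map_cat => -[/eqP + /eqP].
by rewrite !eqseq_cat ?size_map// => /andP[_ /eqP->] /andP[_ /eqP->].
Qed.

Lemma energy_le1 s A : (0 < #|V|)%N -> (forall q, 0 <= A q <= 1) -> energy s A <= 1.
Proof.
move=> V0 A01; rewrite -[leRHS](@avg_cst R (V * V)%type); last by rewrite card_prod muln_gt0 V0.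
apply: ler_avg => q; have /andP[a0 a1] := cond_exp01 (box s) q A01.
exact: exprn_ile1.
Qed.

Lemma energy_ge0 s A : 0 <= energy s A.
Proof. by apply: avg_ge0 => q; apply: sqr_ge0. Qed.

Lemma avg_smooth_sqB t s A :
  avg (fun q => (smooth (t ++ s) A q - smooth s A q) ^+ 2) = energy (t ++ s) A - energy s A.
Proof. by apply: avg_cond_exp_sqB => q q'; apply: box_cat. Qed.

(** With S and T among the generating sets the rectangle is a union of cells, so [A] may be replaced
    by its refined average; Cauchy-Schwarz and Pythagoras turn the discrepancy into energy. *)
Lemma energy_increment s A (S T : {set V}) :
  avg (fun q => (A q - smooth s A q) * rect S T q) ^+ 2 <=
    energy ([:: S; T] ++ s) A - energy s A.
Proof.
rewrite -avg_smooth_sqB; set s' := _ ++ s.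
have -> : avg (fun q => (A q - smooth s A q) * rect S T q) =
    avg (fun q => (smooth s' A q - smooth s A q) * rect S T q).
  have e (f : V * V -> R) : avg (fun q => (f q - smooth s A q) * rect S T q) =
     avg (fun q => f q * rect S T q) + -1 * avg (fun q => smooth s A q * rect S T q).
    by rewrite -avgZ -avgD; apply: eq_avg => q; ring.
  rewrite !e; congr (_ + _); rewrite [RHS]avg_cond_exp// => -[x y] [x' y'].
  rewrite /box /rect /s' /= => -[-> _ _ _ -> _] //.
apply: le_trans (sqr_avg_le _) _; apply: ler_avg => q; rewrite exprMn.
by rewrite ler_piMr ?sqr_ge0// /rect; case: (_ && _); rewrite ?expr1n ?expr0n.
Qed.

(** A violating rectangle adds two sets and at least eps^2 of energy, so j violations would push the
    energy above 1. The bound on [t] is independent of the starting list [s], as the iteration in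
    [strong_regularity] requires. *)
Lemma weak_regularity A (eps : R) s :
    (0 < #|V|)%N -> (forall q, 0 <= A q <= 1) -> 0 < eps ->
    forall j : nat, 1 < j%:R * eps ^+ 2 ->
  exists2 t, (size t <= 2 * j)%N & cut_le eps (fun q => A q - smooth (t ++ s) A q).
Proof.
move=> V0 A01 e0 j hj.
suff : forall i : nat,
    (exists2 t, (size t <= 2 * i)%N & cut_le eps (fun q => A q - smooth (t ++ s) A q)) \/
    exists2 t, (size t <= 2 * i)%N & i%:R * eps ^+ 2 <= energy (t ++ s) A.
  move=> /(_ j) [//|[t _ ht]].
  by have := lt_le_trans hj (le_trans ht (energy_le1 _ V0 A01)); rewrite ltxx.
elim => [|i [[t st ct]|[t st ht]]]; first by right; exists [::]; rewrite // mul0r energy_ge0.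
  by left; exists t => //; apply: leq_trans st _; rewrite leq_mul2l leqnSn orbT.
have [h|/boolp.existsNP[S /boolp.existsNP[T /negP]]] := boolp.pselect (cut_le eps (fun q => A q - smooth (t ++ s) A q)).
  by left; exists t => //; lia.
rewrite -ltNge => h; right; exists ([:: S; T] ++ t); first by rewrite /=; lia.
rewrite -catA.
have := energy_increment (t ++ s) A S T.
have : eps ^+ 2 <= avg (fun q => (A q - smooth (t ++ s) A q) * rect S T q) ^+ 2.
  by rewrite -[leRHS]real_normK ?num_real// lerXn2r// ?nnegrE// ltW.
rewrite -[i.+1]addn1 natrD mulrDl mul1r; lra.
Qed.

End Regularity.

(* Iterating [weak_regularity] from [::], the energy stays below 1, so some step
   increases it by at most [gamma]. *)
Lemma strong_regularity (R : realType) (gamma : R) (eps : nat -> R) :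
    0 < gamma -> (forall i, 0 < eps i) ->
  exists K : nat, forall (V : finType) (A : V * V -> R),
    (0 < #|V|)%N -> (forall q, 0 <= A q <= 1) ->
  exists s t : seq {set V}, [/\ (size s <= K)%N,
    cut_le (eps (size s)) (fun q => A q - smooth (t ++ s) A q) &
    energy (t ++ s) A - energy s A <= gamma].
Proof.
move=> g0 e0.
have bnd (a : R) : 0 < a -> {j : nat | 1 < j%:R * a}.
  move=> a0; exists (Num.bound a^-1); rewrite -ltr_pdivrMr// div1r.
  by apply: archi_boundP; rewrite invr_ge0 ltW.
have e20 i : 0 < eps i ^+ 2 by rewrite exprn_gt0.
pose J i := sval (bnd _ (e20 i)).
have [N hN] := bnd _ g0.
suff IH : forall j : nat, exists K : nat, forall (V : finType) (A : V * V -> R),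
    (0 < #|V|)%N -> (forall q, 0 <= A q <= 1) ->
  (exists s t : seq {set V}, [/\ (size s <= K)%N,
    cut_le (eps (size s)) (fun q => A q - smooth (t ++ s) A q) &
    energy (t ++ s) A - energy s A <= gamma]) \/
  (exists2 s : seq {set V}, (size s <= K)%N & j%:R * gamma <= energy s A).
  have [K hK] := IH N; exists K => V A V0 A01.
  have [//|[s _ hs]] := hK V A V0 A01.
  by have := lt_le_trans hN (le_trans hs (energy_le1 _ V0 A01)); rewrite ltxx.
elim => [|j [K IH]].
  by exists 0%N => V A V0 A01; right; exists [::]; rewrite // mul0r energy_ge0.
(* The precision depends on the size of the list reached so far, of which only the bound [K] is
   known; hence the maximum. *)
exists (K + 2 * \max_(i < K.+1) J i)%N => V A V0 A01.
have [[s [t [sK h1 h2]]]|[s sK hs]] := IH V A V0 A01.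
  by left; exists s, t; split=> //; apply: leq_trans sK (leq_addr _ _).
have [t st ht] := weak_regularity s V0 A01 (e0 (size s)) (svalP (bnd _ (e20 (size s)))).
have [h|h] := leP (energy (t ++ s) A - energy s A) gamma.
  by left; exists s, t; split=> //; apply: leq_trans sK (leq_addr _ _).
right; exists (t ++ s); last by rewrite -addn1 natrD mulrDl mul1r; lra.
rewrite size_cat addnC leq_add//; apply: leq_trans st _; rewrite leq_mul2l /=.
exact: (leq_bigmax (Ordinal (sK : (size s < K.+1)%N)) (F := fun i : 'I_K.+1 => J i)).
Qed.

(** * The induced density as a function of p *)

(** Each edge is listed once, by its endpoints in increasing order of [r]. The rank is left free:
    ordinals come with [val], a general vertex set with [enum_rank]. *)
Lemma card_edges_in (V : finType) (G : sgraph V) (r : V -> nat) (U : {set V}) :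
  injective r ->
  num_edges_in G U =
  #|[set q : V * V | [&& (r q.1 < r q.2)%N, q.1 \in U, q.2 \in U & G q.1 q.2]]%SET|.
Proof.
move=> rI; rewrite /num_edges_in.
pose f (q : V * V) := [set q.1; q.2]%SET.
have -> : edges_in G U = (f @: [set q : V * V | [&& (r q.1 < r q.2)%N, q.1 \in U, q.2 \in U & G q.1 q.2]])%SET.
  apply/setP => e; apply/imset2P/imsetP => [[x y xU]|[[x y]]].
    rewrite inE => /andP[yU Gxy] ->.
    have [rxy|ryx|/rI exy] := ltngtP (r x) (r y).
    - by exists (x, y); rewrite // inE /= rxy xU yU.
    - by exists (y, x); [rewrite inE /= ryx xU yU /= adj_sym | rewrite /f /= finset.setUC].
    - by move: Gxy; rewrite exy adj_irr.
  rewrite inE /= => /and4P[_ xU yU Gxy] ->; apply: (Imset2spec (x1 := x) (x2 := y)) => //.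
  by rewrite inE yU.
rewrite card_in_imset// => -[x y] [x' y']; rewrite !inE /= /f /=.
move=> /and4P[xy _ _ _] /and4P[xy' _ _ _] e.
have : x \in [set x'; y']%SET by rewrite -e !inE eqxx.
have : y \in [set x'; y']%SET by rewrite -e !inE eqxx orbT.
by rewrite !inE => /orP[]/eqP ey /orP[]/eqP ex; move: xy xy'; rewrite ex ey //; lia.
Qed.

Lemma double_edges_in (V : finType) (G : sgraph V) (U : {set V}) :
  (2 * num_edges_in G U)%N = #|[set q : V * V | [&& q.1 \in U, q.2 \in U & G q.1 q.2]]%SET|.
Proof.
pose r (x : V) : nat := enum_rank x.
have rI : injective r by move=> x y /val_inj/enum_rank_inj.
set T := [set q | _]%SET.
rewrite -(cardsID [set q : V * V | (r q.1 < r q.2)%N]%SET T) mul2n -addnn; congr (_ + _)%N.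
  by rewrite (card_edges_in _ _ rI); apply: eq_card => q; rewrite !inE andbC.
rewrite (card_edges_in _ _ rI) -(card_imset _ (can_inj (@swap_pairK V V))).
apply: eq_card => -[x y]; apply/imsetP/idP => [[[x' y']]|].
  rewrite !inE /= => /and4P[h xU yU Gxy] [-> ->].
  by rewrite -leqNgt (ltnW h) xU yU adj_sym.
rewrite !inE -leqNgt /= => /and4P[h xU yU Gxy]; exists (y, x) => //.
rewrite inE /= xU yU adj_sym Gxy !andbT ltn_neqAle h andbT.
by apply: contraTneq Gxy => /rI ->; rewrite adj_irr.
Qed.

Lemma card_pairs (h : nat) : #|[set e : 'I_h * 'I_h | (e.1 < e.2)%N]%SET| = 'C(h, 2).
Proof.
rewrite -sum1_card (eq_bigl (fun e : 'I_h * 'I_h => predT e.1 && (e.1 < e.2)%N)) => [|e]; last by rewrite inE.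
rewrite -(pair_big_dep predT (fun i j : 'I_h => (i < j)%N) (fun _ _ => 1%N)) /=.
rewrite (exchange_big_dep predT)//= -bin2_sum big_mkord; apply: eq_bigr => j _.
by rewrite -(big_ord_widen _ (fun=> 1%N) (ltnW (ltn_ord j))) sum1_card card_ord.
Qed.

Lemma num_edges_le (h : nat) (H : sgraph 'I_h) : (num_edges H <= 'C(h, 2))%N.
Proof.
rewrite -card_pairs /num_edges (card_edges_in _ _ val_inj).
by apply/subset_leq_card/fintype.subsetP => e; rewrite !inE => /andP[].
Qed.

Lemma prod_kern (R : realType) (h : nat) (H : sgraph 'I_h) (a : R) :
  \prod_(e : 'I_h * 'I_h | (e.1 < e.2)%N) kern (H e.1 e.2) a = ind_density H a.
Proof.
rewrite (bigID (fun e => H e.1 e.2)) /= /ind_density.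
pose P : pred ('I_h * 'I_h) := fun e => (e.1 < e.2)%N.
have cE : #|[pred e : 'I_h * 'I_h | (e.1 < e.2)%N && H e.1 e.2]| = num_edges H.
  by rewrite /num_edges (card_edges_in _ _ val_inj); apply: eq_card => e; rewrite !inE.
have cN : #|[pred e : 'I_h * 'I_h | (e.1 < e.2)%N && ~~ H e.1 e.2]| = ('C(h, 2) - num_edges H)%N.
  rewrite -card_pairs -cE -[in RHS](cardsID [set e : 'I_h * 'I_h | H e.1 e.2]%SET).
  rewrite [X in (X + _ - _)%N](_ : _ = #|[pred e : 'I_h * 'I_h | (e.1 < e.2)%N && H e.1 e.2]|).
    by rewrite addnC addnK; apply: eq_card => e; rewrite !inE andbC.
  by apply: eq_card => e; rewrite !inE.
rewrite -[in RHS]cN -[in RHS]cE -!prodr_const; congr (_ * _).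
  by apply: eq_bigr => e /andP[_ ->].
by apply: eq_bigr => e /andP[_ /negbTE->].
Qed.

Section DensityPolynomial.
Variable R : realType.

Definition dens_poly (e m : nat) : {poly R} := 'X^e * (1 - 'X) ^+ m.

Lemma dens_polyE e m x : (dens_poly e m).[x] = x ^+ e * (1 - x) ^+ m.
Proof. by rewrite !hornerE. Qed.

(** The factor X (1 - X) avoids the exponents e - 1 and m - 1. On the right stands f times a
    polynomial of degree at most 1, whose root e/(e+m) is the only possible critical point in (0,
    1). *)
Lemma dens_poly_deriv e m :
  'X * (1 - 'X) * (dens_poly e m)^`() = dens_poly e m * ((1 - 'X) *+ e - 'X *+ m).
Proof.
have dX : 'X * ('X^e)^`() = 'X^e *+ e :> {poly R}.
  by rewrite derivXn; case: e => [|e]; rewrite ?mulr0n ?mulr0// mulrnAr -exprS.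
have dN : (1 - 'X) * ((1 - 'X) ^+ m)^`() = - ((1 - 'X) ^+ m *+ m) :> {poly R}.
  rewrite deriv_exp derivB derivC derivX sub0r.
  by case: m => [|m]; rewrite ?mulr0n ?mulr0 ?oppr0// mulN1r mulrnAr mulrN -exprS mulNrn.
rewrite /dens_poly derivM.
have -> : 'X * (1 - 'X) * (('X^e)^`() * (1 - 'X) ^+ m + 'X^e * ((1 - 'X) ^+ m)^`()) =
  ('X * ('X^e)^`()) * ((1 - 'X) * (1 - 'X) ^+ m) + ('X * 'X^e) * ((1 - 'X) * ((1 - 'X) ^+ m)^`()) :> {poly R}.
  by ring.
by rewrite dX dN; ring.
Qed.

Lemma dens_poly_crit e m c : (0 < e + m)%N -> 0 < c < 1 ->
  (dens_poly e m)^`().[c] = 0 -> c = e%:R / (e + m)%:R.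
Proof.
move=> em /andP[c0 c1] dc; have := congr1 (horner^~ c) (dens_poly_deriv e m).
rewrite hornerM dc mulr0 hornerM => /esym/eqP; rewrite mulf_eq0 dens_polyE.
rewrite mulf_eq0 !expf_eq0 subr_eq0 [1 == c]eq_sym (lt_eqF c1) (gt_eqF c0) !andbF /=.
rewrite !hornerE => /eqP h.
have em0 : (e + m)%:R != 0 :> R by rewrite pnatr_eq0 -lt0n.
apply: (mulIf em0); rewrite divfK// natrD mulrDr; move: h.
rewrite !hornerMn !hornerE -[(1 - c) *+ e]mulr_natr -[c *+ m]mulr_natr; lra.
Qed.

Lemma dens_poly_three e m x y z : (0 < e + m)%N -> 0 < x -> z < 1 -> x < y -> y < z ->
  (dens_poly e m).[x] = (dens_poly e m).[y] ->
  (dens_poly e m).[y] = (dens_poly e m).[z] -> False.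
Proof.
move=> em x0 z1 xy yz exy eyz.
have [c + dc] := poly_rolle xy exy; have [d + dd] := poly_rolle yz eyz.
rewrite !in_itv /= => /andP[yd dz] /andP[xc cy].
have c01 : 0 < c < 1 by apply/andP; split; lra.
have d01 : 0 < d < 1 by apply/andP; split; lra.
have := dens_poly_crit em c01 dc; rewrite -(dens_poly_crit em d01 dd); lra.
Qed.
End DensityPolynomial.

Section DensityStability.
Variables (R : realType) (h : nat) (H : sgraph 'I_h) (p : R).
Hypotheses (hh : (2 <= h)%N) (hp : 0 < p < 1).
Let q := conj_density H p.

Let f := dens_poly R (num_edges H) ('C(h, 2) - num_edges H).

Lemma horner_ind_density x : f.[x] = ind_density H x.
Proof. exact: dens_polyE. Qed.

Let em : (0 < num_edges H + ('C(h, 2) - num_edges H))%N.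
Proof. by rewrite subnKC ?num_edges_le// bin_gt0. Qed.

Lemma ind_density_gt0_lt1 : 0 < ind_density H p < 1.
Proof.
have /andP[p0 p1] := hp; have q0 : 0 < 1 - p by rewrite subr_gt0.
have q1 : 1 - p < 1 by rewrite ltrBlDr ltrDl.
rewrite /ind_density mulr_gt0 ?exprn_gt0//=.
case: (num_edges H) em => [|e] em'.
  by rewrite expr0 mul1r exprn_ilt1 ?(ltW q0) ?(ltW q1)// -lt0n.
apply: le_lt_trans (_ : p ^+ e.+1 < 1); last by rewrite exprn_ilt1 ?(ltW p0) ?(ltW p1).
by rewrite ler_piMr ?exprn_ge0 ?exprn_ile1 ?(ltW p0) ?(ltW q0) ?(ltW q1).
Qed.

Lemma ind_density_eq x : 0 <= x <= 1 -> ind_density H x = ind_density H p -> x = p \/ x = q.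
Proof.
move=> /andP[x0 x1] e; have /andP[p0 p1] := hp.
have [->|xp] := eqVneq x p; [by left | right].
(* At the endpoints the density is 0 or 1, values excluded by [ind_density_gt0_lt1]. *)
have x01 : 0 < x < 1.
  have /andP[d0 d1] := ind_density_gt0_lt1.
  rewrite !lt_neqAle x0 x1 !andbT; apply/andP; split; apply/eqP => xe;
    move: d0 d1; rewrite -e /ind_density.
    by rewrite -xe subr0 expr1n mulr1 expr0n; case: eqP => _; rewrite ?ltxx.
  by rewrite xe subrr expr1n mul1r expr0n; case: eqP => _; rewrite ?ltxx.
(* [x] witnesses that a second solution exists, so [q] is such a solution and not the default
   [p]. *)
have : [set y : R | [/\ 0 < y < 1, ind_density H y = ind_density H p & y != p]]%classic q.
  by apply: xgetPex; exists x.
move=> /= [q01 eq qp]; apply/eqP; apply/negPn/negP => xq.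
have three a b c : a \in [:: x; p; q] -> b \in [:: x; p; q] -> c \in [:: x; p; q] -> a < b -> b < c -> False.
  have all_eq y : y \in [:: x; p; q] -> 0 < y < 1 /\ f.[y] = f.[p].
    by rewrite !inE => /or3P[]/eqP->; rewrite !horner_ind_density.
  move=> /all_eq[/andP[a0 _] ea] /all_eq[_ eb] /all_eq[/andP[_ c1] ec] ab bc.
  exact: (dens_poly_three em a0 c1 ab bc (etrans ea (esym eb)) (etrans eb (esym ec))).
have xpI : x \in [:: x; p; q] by rewrite !inE eqxx.
have pI : p \in [:: x; p; q] by rewrite !inE eqxx orbT.
have qI : q \in [:: x; p; q] by rewrite !inE eqxx !orbT.
case: (ltgtP x p) (xp) => // h1 _; case: (ltgtP x q) (xq) => // h2 _; case: (ltgtP q p) (qp) => // h3 _.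
all: try by apply: (three x p q).
all: try by apply: (three x q p).
all: try by apply: (three p x q).
all: try by apply: (three p q x).
all: try by apply: (three q p x).
all: try by apply: (three q x p).
all: lra.
Qed.

Lemma ind_density_stable (zeta : R) : 0 < zeta ->
  exists2 kappa : R, 0 < kappa & forall a, 0 <= a <= 1 ->
    `|ind_density H a - ind_density H p| <= kappa ->
    `|a - p| <= zeta \/ `|a - q| <= zeta.
Proof.
move=> z0.
(* The two tents vanish outside the zeta-neighbourhoods of p and q and are positive at p and q, so g
   is positive on [0, 1]; half its minimum serves as [kappa]. *)
pose g (x : R) : R := `|f.[x] - f.[p]| + (Num.max 0 (zeta - `|x - p|) + Num.max 0 (zeta - `|x - q|)).
have cg : continuous g.
  have cp : continuous (horner f) by exact: continuous_horner.
  have cd r : continuous (fun x : R => Num.max 0 (zeta - `|x - r|)).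
    move=> x; apply: (@continuous_max _ _ (fun=> 0) (fun x : R => zeta - `|x - r|)).
      exact: cvg_cst.
    by apply: cvgB; [exact: cvg_cst | apply: cvg_norm; apply: cvgB; [exact: cvg_id | exact: cvg_cst]].
  move=> x; apply: cvgD; last by apply: cvgD; apply: cd.
  by apply: cvg_norm; apply: cvgB; [exact: cp | exact: cvg_cst].
have cg' : ({within `[0, 1], continuous g})%classic by apply: continuous_subspaceT.
have [c c01 hc] := EVT_min ler01 cg'.
have gc : 0 < g c.
  rewrite in_itv /= in c01.
  have m0 (x : R) : 0 <= Num.max 0 x by rewrite le_max lexx.
  have mz : 0 < Num.max 0 (zeta - `|c - c|) by rewrite subrr normr0 subr0 lt_max z0 orbT.
  have [cp|cp] := eqVneq c p; first by rewrite /g -cp ltr_wpDl// ltr_pwDl.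
  have [cq|cq] := eqVneq c q; first by rewrite /g -cq ltr_wpDl// ltr_wpDl.
  rewrite /g ltr_pwDl ?addr_ge0// normr_gt0 subr_eq0 !horner_ind_density.
  by apply/eqP => /(ind_density_eq c01)[]/eqP; apply/negP.
exists (g c / 2); first by rewrite divr_gt0.
move=> a a01 ha.
have {}hc := hc a; rewrite in_itv /= a01 in hc; have {}hc := hc isT.
have [h1|h1] := leP `|a - p| zeta; first by left.
have [h2|h2] := leP `|a - q| zeta; first by right.
move: hc; rewrite {2}/g !horner_ind_density.
by rewrite !max_l ?subr_le0 ?(ltW h1) ?(ltW h2)// !addr0; lra.
Qed.
End DensityStability.

(** * Counting lemma *)

Section Counting.
Variables (R : realType) (V : finType).
Hypothesis V0 : (0 < #|V|)%N.

Lemma sum_mul_le_pos (a f : V -> R) : (forall x, 0 <= f x <= 1) ->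
  \sum_x a x * f x <= \sum_x a x * (x \in [set x | 0 < a x])%:R.
Proof.
move=> f01; apply: ler_sum => x _; have /andP[f0 f1] := f01 x.
rewrite inE; have [a0|a0] := ltP 0 (a x).
  by rewrite mulr1 ler_piMr// ltW.
by rewrite mulr0 mulr_le0_ge0.
Qed.

(** The form is bilinear: for fixed g the best f with values in [0, 1] is the indicator of a sign
    set, and then likewise for g. The lower bound is the upper bound for - D. *)
Lemma cut_le_fun (eps : R) (D : V * V -> R) (f g : V -> R) :
    cut_le eps D -> (forall x, 0 <= f x <= 1) -> (forall x, 0 <= g x <= 1) ->
  `|avg (fun q => D q * (f q.1 * g q.2))| <= eps.
Proof.
move=> cutD f01 g01.
have upper (D' : V * V -> R) : cut_le eps D' -> avg (fun q => D' q * (f q.1 * g q.2)) <= eps.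
  move=> cutD'.
  have sumE (u t : V -> R) : \sum_q D' q * (u q.1 * t q.2) = \sum_x \sum_y D' (x, y) * (u x * t y).
    by rewrite pair_big; apply: eq_bigr => -[].
  pose S := [set x | 0 < \sum_y D' (x, y) * g y].
  pose T := [set y | 0 < \sum_x D' (x, y) * (x \in S)%:R].
  apply: le_trans (le_trans (ler_norm _) (cutD' S T)).
  rewrite /avg ler_wpM2r ?invr_ge0 ?ler0n//.
  apply: le_trans (_ : \sum_q D' q * ((q.1 \in S)%:R * g q.2) <= _).
    rewrite (sumE f g) (sumE (fun x => (x \in S)%:R) g).
    have e (u : V -> R) : \sum_x \sum_y D' (x, y) * (u x * g y) = \sum_x (\sum_y D' (x, y) * g y) * u x.
      by apply: eq_bigr => x _; rewrite mulr_suml; apply: eq_bigr => y _; ring.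
    rewrite (e f) (e (fun x => (x \in S)%:R)); exact: sum_mul_le_pos.
  have -> : \sum_q D' q * rect R S T q = \sum_x \sum_y D' (x, y) * ((x \in S)%:R * (y \in T)%:R).
    rewrite -(sumE (fun x => (x \in S)%:R) (fun y => (y \in T)%:R)).
    by apply: eq_bigr => q _; rewrite /rect -natrM mulnb.
  have -> := sumE (fun x => (x \in S)%:R) g.
  rewrite exchange_big [leRHS]exchange_big /=.
  have e (u : V -> R) : \sum_y \sum_x D' (x, y) * ((x \in S)%:R * u y) = \sum_y (\sum_x D' (x, y) * (x \in S)%:R) * u y.
    by apply: eq_bigr => y _; rewrite mulr_suml; apply: eq_bigr => x _; ring.
  rewrite (e g) (e (fun x => (x \in T)%:R)); exact: sum_mul_le_pos.
rewrite ler_norml upper// andbT lerNl -mulN1r -avgZ.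
rewrite (eq_avg (g := fun q => (- D q) * (f q.1 * g q.2))) => [|q]; last by ring.
apply: upper => S T.
rewrite (eq_avg (g := fun q => -1 * (D q * rect R S T q))) => [|q]; last by ring.
by rewrite avgZ mulN1r normrN.
Qed.

Variable h : nat.

Definition upd (v : {ffun 'I_h -> V}) (i : 'I_h) (x : V) : {ffun 'I_h -> V} :=
  [ffun j => if j == i then x else v j].

(** Exchanging the coordinate i of [v] with the fresh sample is an involution of the product
    space. *)
Lemma avg_upd (F : {ffun 'I_h -> V} -> R) (i : 'I_h) :
  avg F = avg (fun v => avg (fun x => F (upd v i x))).
Proof.
rewrite -(avg_pair (fun p : {ffun 'I_h -> V} * V => F (upd p.1 i p.2))).
pose s (p : {ffun 'I_h -> V} * V) := (upd p.1 i p.2, p.1 i).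
have sK : involutive s.
  move=> [v x]; rewrite /s /= ffunE eqxx; congr (_, _).
  by apply/ffunP => j; rewrite !ffunE; case: eqP => // ->.
transitivity (avg (fun p : {ffun 'I_h -> V} * V => F p.1)).
  by rewrite avg_pair; apply: eq_avg => v /=; rewrite avg_cst.
by congr (_ / _); rewrite (reindex_inj (inv_inj sK)).
Qed.

Lemma avg_cut (eps : R) (D : V * V -> R) (i k : 'I_h) (f g : {ffun 'I_h -> V} -> R) :
    i != k -> cut_le eps D ->
    (forall v, 0 <= f v <= 1) -> (forall v, 0 <= g v <= 1) ->
    (forall v z, f (upd v k z) = f v) -> (forall v x, g (upd v i x) = g v) ->
  `|avg (fun v : {ffun 'I_h -> V} => D (v i, v k) * (f v * g v))| <= eps.
Proof.
move=> ik cutD f01 g01 fk gi.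
rewrite (avg_upd _ k) (avg_upd _ i).
have W0 : (0 < #|{ffun 'I_h -> V}|)%N by apply: card_ffun_gt0.
apply: le_trans (ler_norm_avg _) _; rewrite -[leRHS](avg_cst eps W0).
apply: ler_avg => v.
apply: le_trans (cut_le_fun cutD (fun x => f01 (upd v i x)) (fun z => g01 (upd v k z))).
rewrite avg_pair le_eqVlt; apply/orP; left; apply/eqP; congr `|_|.
apply: eq_avg => x; apply: eq_avg => z /=.
have e : upd (upd v i x) k z = upd (upd v k z) i x.
  apply/ffunP => j; rewrite !ffunE; case: (eqVneq j k) => [->|//].
  by rewrite eq_sym (negbTE ik).
by rewrite fk {3}e gi !ffunE eqxx (negbTE ik) eqxx.
Qed.

(** With the other coordinates fixed, the factors apart from (i, k) split into those without v_k and
    those with v_k; the latter do not involve v_i, since the pair (i, k) has been taken out.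
    [avg_cut] then applies. *)
Lemma avg_pairprod_step (eps : R) (X Y : 'I_h * 'I_h -> V -> V -> R) (U : 'I_h -> {set V})
    (e0 : 'I_h * 'I_h) :
    (e0.1 < e0.2)%N -> (forall e x y, 0 <= X e x y <= 1) ->
    (forall e, e != e0 -> Y e = X e) ->
    cut_le eps (fun q => Y e0 q.1 q.2 - X e0 q.1 q.2) ->
  `|avg (fun v : {ffun 'I_h -> V} => (\prod_j (v j \in U j)%:R) * (pairprod Y v - pairprod X v))| <= eps.
Proof.
case: e0 => i k /= ik X01 YX cutD.
have nik : i != k by apply: contraTneq ik => ->; rewrite ltnn.
pose touch (e : 'I_h * 'I_h) := (e.1 == k) || (e.2 == k).
pose rest (e : 'I_h * 'I_h) := (e.1 < e.2)%N && (e != (i, k)).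
pose f (v : {ffun 'I_h -> V}) : R := (\prod_(j | j != k) (v j \in U j)%:R) *
  \prod_(e | rest e && ~~ touch e) X e (v e.1) (v e.2).
pose g (v : {ffun 'I_h -> V}) : R := (v k \in U k)%:R *
  \prod_(e | rest e && touch e) X e (v e.1) (v e.2).
have in01 (v : {ffun 'I_h -> V}) j : 0 <= ((v j \in U j)%:R : R) <= 1 by case: (_ \in _); rewrite ler01 lexx.
have mul01 (a b : R) : 0 <= a <= 1 -> 0 <= b <= 1 -> 0 <= a * b <= 1.
  by move=> /andP[? ?] /andP[? ?]; rewrite mulr_ge0// mulr_ile1.
rewrite (eq_avg (g := fun v : {ffun 'I_h -> V} => (Y (i, k) (v i) (v k) - X (i, k) (v i) (v k)) * (f v * g v))).
  apply: (avg_cut (D := fun q => Y (i, k) q.1 q.2 - X (i, k) q.1 q.2) nik cutD).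
  - by move=> v; apply: mul01; apply: prod_itv01 => ?; [exact: in01 | exact: X01].
  - by move=> v; apply: mul01; [exact: in01 | apply: prod_itv01 => ?; exact: X01].
  - move=> v z; congr (_ * _).
      by apply: eq_bigr => j jk; rewrite ffunE (negbTE jk).
    apply: eq_bigr => e /andP[_]; rewrite negb_or => /andP[h1 h2].
    by rewrite !ffunE (negbTE h1) (negbTE h2).
  - move=> v x; congr (_ * _); first by rewrite ffunE eq_sym (negbTE nik).
    apply: eq_bigr => -[a b] /= /andP[/andP[/= ab nab] tab].
    rewrite !ffunE; case: (eqVneq a i) => [ai|_]; case: (eqVneq b i) => [bi|_] //.
    - by move: ab; rewrite ai bi ltnn.
    - by move: tab nab; rewrite /touch /= ai (negbTE nik) /= => /eqP->; rewrite eqxx.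
    - move: tab; rewrite /touch /= bi (negbTE nik) orbF => /eqP ak.
      by move: ab; rewrite ak bi; lia.
move=> v; rewrite /pairprod (bigD1 (i, k))//= [X in _ - X](bigD1 (i, k))//=.
rewrite (eq_bigr (fun e => X e (v e.1) (v e.2))) => [|e /andP[_ ne]]; last by rewrite YX.
rewrite -mulrBl /f /g (bigD1 k)//= [X in _ * (_ * X) = _](bigID touch) /= /rest.
ring.
Qed.

(** Pairs are switched from [X] to [Y] one at a time, each at cost [eps]; the hybrid [H r] has been
    switched at the pairs in [r]. *)
Lemma counting (eps : R) (X Y : 'I_h * 'I_h -> V -> V -> R) (U : 'I_h -> {set V}) :
    0 <= eps -> (forall e x y, 0 <= X e x y <= 1) -> (forall e x y, 0 <= Y e x y <= 1) ->
    (forall e, cut_le eps (fun q => Y e q.1 q.2 - X e q.1 q.2)) ->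
  `|avg (fun v : {ffun 'I_h -> V} => (\prod_j (v j \in U j)%:R) * (pairprod Y v - pairprod X v))|
     <= (h * h)%:R * eps.
Proof.
move=> eps0 X01 Y01 cutD.
pose H (r : seq ('I_h * 'I_h)) e := if e \in r then Y e else X e.
have H01 r e x y : 0 <= H r e x y <= 1 by rewrite /H; case: ifP.
have hybrid r : all (fun e : 'I_h * 'I_h => (e.1 < e.2)%N) r ->
  `|avg (fun v : {ffun 'I_h -> V} => (\prod_j (v j \in U j)%:R) * (pairprod (H r) v - pairprod X v))| <= (size r)%:R * eps.
  elim: r => [_|e r IH /= /andP[lte /IH {}IH]].
    rewrite (eq_avg (g := fun _ : {ffun 'I_h -> V} => 0 * 0 : R)) => [|v]; first by rewrite avgZ mul0r normr0 mul0r.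
    by rewrite mul0r (_ : pairprod (H [::]) v = pairprod X v) ?subrr ?mulr0.
  have step : `|avg (fun v : {ffun 'I_h -> V} => (\prod_j (v j \in U j)%:R) * (pairprod (H (e :: r)) v - pairprod (H r) v))| <= eps.
    have [er|er] := boolP (e \in r).
      rewrite (eq_avg (g := fun _ : {ffun 'I_h -> V} => 0 * 0 : R)) => [|v]; first by rewrite avgZ mul0r normr0.
      rewrite mul0r (_ : pairprod (H (e :: r)) v = pairprod (H r) v) ?subrr ?mulr0//.
      by apply: eq_bigr => e' _; rewrite /H inE; case: eqVneq => // ->; rewrite er.
    apply: (@avg_pairprod_step eps (H r) (H (e :: r)) U e) => //.
      by move=> e' ne; rewrite /H inE (negbTE ne).
    by rewrite /H inE eqxx (negbTE er) /=.
  rewrite (eq_avg (g := fun v : {ffun 'I_h -> V} => (\prod_j (v j \in U j)%:R) * (pairprod (H (e :: r)) v - pairprod (H r) v)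
     + (\prod_j (v j \in U j)%:R) * (pairprod (H r) v - pairprod X v))) => [|v]; last by ring.
  by rewrite avgD; apply: le_trans (ler_normD _ _) _; rewrite -addn1 natrD mulrDl mul1r addrC lerD.
pose r := enum [pred e : 'I_h * 'I_h | (e.1 < e.2)%N].
have HY v : pairprod (H r) v = pairprod Y v.
  by apply: eq_bigr => e lte; rewrite /H mem_enum inE lte.
have := hybrid r; rewrite (eq_avg (g := fun v : {ffun 'I_h -> V} => (\prod_j (v j \in U j)%:R) * (pairprod Y v - pairprod X v))) => [hr|v].
  apply: le_trans (hr _) _; first by apply/allP => e; rewrite mem_enum.
  rewrite ler_wpM2r// ler_nat -cardE; apply: leq_trans (max_card _) _.
  by rewrite card_prod card_ord.
by rewrite HY.
Qed.
End Counting.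

(** * Decomposition into blocks *)

Section Blocks.
Variables (V : finType) (K : eqType) (c : V -> K) (m : nat).

(** Blocks share the size [m] because the hypothesis on G concerns sets of equal size. The colour
    [c] will be the atom of a vertex, so that step kernels are constant on pairs of blocks. *)
Definition block_family (P : {set {set V}}) :=
  finset.trivIset P && [forall B in P, (#|B| == m) &&
    [forall x in B, forall y in B, c x == c y]].

(** In a family with the most blocks, m uncovered points of one colour would form a further
    block. *)
Lemma exists_blocks : (0 < m)%N ->
  exists2 P, block_family P & forall t : K, (#|[set x | (x \notin finset.cover P) && (c x == t)]| < m)%N.
Proof.
move=> m0.
have b0 : block_family finset.set0.
  apply/andP; split; first by apply/finset.trivIsetP => A B; rewrite inE.
  by apply/forallP => B; rewrite inE.
have [P bP maxP] := arg_maxnP (fun P : {set {set V}} => #|P|) b0.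
exists P => // t; rewrite ltnNge; apply/negP => /card_geqP[s [us ss sP]].
pose B := [set x in s].
have cB : #|B| = m by rewrite cardsE (card_uniqP us).
have BP x : x \in B -> (x \notin finset.cover P) && (c x == t).
  by rewrite inE => /sP; rewrite inE.
have dB A : A \in P -> [disjoint B & A].
  move=> AP; rewrite -finset.setI_eq0; apply/eqP/finset.setP => x; rewrite !inE; apply/negP => /andP[xs xA].
  have /BP/andP[/negP + _] : x \in B by rewrite inE.
  by apply; apply/bigcupP; exists A.
have BnP : B \notin P.
  apply/negP => /dB; rewrite -finset.setI_eq0 finset.setIid => /eqP B0.
  by move: m0; rewrite -cB B0 cards0.
have : (#|B |: P| <= #|P|)%N.
  apply: maxP; have /andP[tP /forallP hP] := bP; apply/andP; split.
    apply/finset.trivIsetP => A A'; rewrite !inE => /orP[/eqP->|AP] /orP[/eqP->|AP'] //.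
    - by rewrite eqxx.
    - by move=> _; apply: dB.
    - by move=> _; rewrite disjoint_sym; apply: dB.
    - by move/finset.trivIsetP: tP; apply.
  apply/forallP => A; rewrite !inE; apply/implyP => /orP[/eqP->|AP]; last first.
    by have := hP A; rewrite AP.
  rewrite cB eqxx /=; apply/forallP => x; apply/implyP => /BP/andP[_ /eqP->].
  by apply/forallP => y; apply/implyP => /BP/andP[_ /eqP->].
by rewrite cardsU1 BnP ltnn.
Qed.


Variable P : {set {set V}}.
Hypothesis bP : block_family P.

Lemma card_block B : B \in P -> #|B| = m.
Proof. by case/andP: bP => _ /forallP/(_ B)/implyP h /h/andP[/eqP]. Qed.

Lemma block_mono B x y : B \in P -> x \in B -> y \in B -> c x = c y.
Proof.
case/andP: bP => _ /forallP/(_ B)/implyP h /h/andP[_ /forallP/(_ x)/implyP h'] /h'.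
by move=> /forallP/(_ y)/implyP h'' /h''/eqP.
Qed.

Lemma card_blocks_le : (#|P| * m <= #|V|)%N.
Proof.
case/andP: (bP) => /eqP tP _; apply: leq_trans (max_card (finset.cover P)).
rewrite -tP -sum_nat_const; apply: leq_sum => B /card_block->; exact: leqnn.
Qed.

Lemma card_pblock_le x : (#|finset.pblock P x| <= m)%N.
Proof.
have [xP|] := boolP (x \in finset.cover P); first by rewrite card_block ?finset.pblock_mem.
by rewrite /finset.pblock; case: pickP => [B /andP[/card_block-> _]|_] _ //=; rewrite cards0.
Qed.
End Blocks.

Section BlockL1.
Variables (R : realType) (V K : finType) (c : V -> K) (m h : nat).
Variable P : {set {set V}}.
Hypothesis V0 : (0 < #|V|)%N.
Hypothesis bP : block_family c m P.
Hypothesis rP : forall t : K, (#|[set x | (x \notin finset.cover P) && (c x == t)]| < m)%N.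
Implicit Types (F G : {ffun 'I_h -> V} -> R) (B : {ffun 'I_h -> {set V}}).

Let n : R := #|V|%:R.

Definition in_box (B : 'I_h -> {set V}) (v : {ffun 'I_h -> V}) : R := \prod_j (v j \in B j)%:R.

Lemma in_boxE (B : 'I_h -> {set V}) v : in_box B v = [forall j, v j \in B j]%:R.
Proof.
rewrite /in_box; case: forallP => [h1|/forallP]; first by rewrite big1 // => j _; rewrite h1.
rewrite negb_forall => /existsP[j /negbTE jB].
by rewrite (bigD1 j)//= jB mul0r.
Qed.

(** Distinct blocks, since the hypothesis on G is about pairwise disjoint sets. *)
Definition box_ok B := [forall j, B j \in P] && injectiveb B.

Lemma card_box_ok : (#|[pred B | box_ok B]| <= #|P| ^ h)%N.
Proof.
rewrite -[X in (_ <= _ ^ X)%N]card_ord -card_ffun_on.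
apply/subset_leq_card/fintype.subsetP => B; rewrite inE => /andP[/forallP h1 _].
by apply/ffun_onP.
Qed.

Lemma uncovered_le : avg (fun x => (x \notin finset.cover P)%:R : R) <= #|K|%:R * m%:R / n.
Proof.
rewrite /avg ler_wpM2r ?invr_ge0 ?ler0n// -natr_sum -natrM ler_nat.
rewrite (partition_big c predT)//= -sum_nat_const; apply: leq_sum => t _.
rewrite -big_mkcondr /= sum1_card; apply: leq_trans (ltnW (rP t)).
by apply/subset_leq_card/fintype.subsetP => x; rewrite !inE andbC.
Qed.

(** [pblock] is empty off the cover; the first conjunct keeps two uncovered points from counting as
    a common block. *)
Definition same_block (q : V * V) := (q.1 \in finset.cover P) && (finset.pblock P q.1 == finset.pblock P q.2).

Lemma same_block_le : avg (fun q => (same_block q)%:R : R) <= m%:R / n.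
Proof.
rewrite avg_pair -[leRHS](@avg_cst R V)//; apply: ler_avg => x.
rewrite /avg ler_wpM2r ?invr_ge0 ?ler0n// -natr_sum ler_nat.
apply: leq_trans (card_pblock_le bP x); rewrite -sum1_card [leqRHS]big_mkcond /=.
apply: leq_sum => y _; rewrite /same_block /=; case: (boolP (x \in finset.cover P)) => //= xP.
case/andP: bP => tP _.
by rewrite finset.eq_pblock//; case: (y \in _).
Qed.

(** Tuples with an uncovered vertex or with two vertices in one block are bounded trivially; the
    others lie in admissible boxes. The boxes are disjoint, so |F - G| is paid once in total,
    whereas [rho] is paid once per box. *)
Lemma avg_norm_blocks F G (rho : R) :
    (forall v, `|F v| <= 1) ->
    (forall v v' : {ffun 'I_h -> V}, (forall i, c (v i) = c (v' i)) -> F v = F v') ->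
    (forall B, box_ok B -> `|avg (fun v => in_box B v * G v)| <= rho) -> 0 <= rho ->
  avg (fun v => `|F v|) <= h%:R * (#|K|%:R * m%:R / n) + (h * h)%:R * (m%:R / n) +
     (avg (fun v => `|F v - G v|) + (#|P| ^ h)%:R * rho).
Proof.
move=> F1 Fc hG rho0.
have ptw (v : {ffun 'I_h -> V}) : `|F v| <= \sum_i (v i \notin finset.cover P)%:R +
    \sum_(p : 'I_h * 'I_h | p.1 != p.2) (same_block (v p.1, v p.2))%:R +
    \sum_(B | box_ok B) in_box B v * `|F v|.
  have s1 : 0 <= \sum_i (v i \notin finset.cover P)%:R :> R by apply: sumr_ge0 => *; apply: ler0n.
  have s2 : 0 <= \sum_(p : 'I_h * 'I_h | p.1 != p.2) (same_block (v p.1, v p.2))%:R :> R.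
    by apply: sumr_ge0 => *; apply: ler0n.
  have s3 : 0 <= \sum_(B | box_ok B) in_box B v * `|F v|.
    by apply: sumr_ge0 => B _; rewrite in_boxE mulr_ge0// ler0n.
  have [/forallP cov|] := boolP [forall i, v i \in finset.cover P]; last first.
    rewrite negb_forall => /existsP[i vi]; apply: le_trans (F1 v) _.
    rewrite -addrA ler_wpDr ?addr_ge0// (bigD1 i)//= vi ler_wpDr// sumr_ge0// => *; exact: ler0n.
  pose B := [ffun i => finset.pblock P (v i)].
  have [ok|] := boolP (box_ok B).
    rewrite ler_wpDl ?addr_ge0// (bigD1 B)//= in_boxE.
    have -> : [forall j, v j \in B j] by apply/forallP => j; rewrite ffunE finset.mem_pblock.
    by rewrite mul1r ler_wpDr// sumr_ge0// => B' _; rewrite in_boxE mulr_ge0// ler0n.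
  rewrite negb_and => /orP[/forallP[]|]; first by move=> j; rewrite ffunE finset.pblock_mem.
  move=> /injectivePn[i [j ij]]; rewrite !ffunE => e; apply: le_trans (F1 v) _.
  rewrite ler_wpDr// ler_wpDl// (bigD1 (i, j))//= {1}/same_block /= cov e eqxx.
  by rewrite ler_wpDr// sumr_ge0// => *; exact: ler0n.
apply: le_trans (ler_avg ptw) _; rewrite !avgD !avg_sum; apply: lerD; [apply: lerD|].
- apply: le_trans (_ : \sum_(i < h) (#|K|%:R * m%:R / n) <= _).
    apply: ler_sum => i _; apply: le_trans uncovered_le.
    by rewrite (avg_ffun1 V0 i (fun x => (x \notin finset.cover P)%:R)).
  by rewrite sumr_const card_ord -[X in X <= _]mulr_natl.
- have r0 : 0 <= m%:R / n :> R by rewrite divr_ge0 ?ler0n.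
  apply: le_trans (_ : \sum_(p : 'I_h * 'I_h) (m%:R / n) <= _); last first.
    by rewrite sumr_const card_prod card_ord -[X in X <= _]mulr_natl.
  rewrite big_mkcond; apply: ler_sum => -[i j] _; case: ifP => //= ij.
  apply: le_trans same_block_le.
  by rewrite (avg_ffun2 V0 (fun q => (same_block q)%:R))//= inE andbT.
have boxF B : box_ok B -> avg (fun v => in_box B v * `|F v|) = `|avg (fun v => in_box B v * F v)|.
  move=> /andP[/forallP BP _].
  have [/existsP[v0 /forallP v0B]|] := boolP [exists v : {ffun 'I_h -> V}, [forall j, v j \in B j]].
    have Fv0 v : in_box B v * F v = F v0 * in_box B v.
      rewrite mulrC in_boxE; case: forallP => [vB|_]; last by rewrite !mulr0.
      by rewrite (Fc v v0)// => i; apply: (block_mono bP (BP i)).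
    rewrite (eq_avg Fv0) avgZ normrM [`|avg _|]ger0_norm; last first.
      by apply: avg_ge0 => v; rewrite in_boxE ler0n.
    rewrite -avgZ; apply: eq_avg => v.
    have b0 : 0 <= in_box B v by rewrite in_boxE ler0n.
    by rewrite -{1}(ger0_norm b0) -normrM Fv0 normrM (ger0_norm b0).
  rewrite negb_exists => /forallP no.
  have z v : in_box B v = 0 by rewrite in_boxE (negbTE (no v)).
  rewrite [X in `|X|](eq_avg (g := fun v => 0 * F v)) => [|v]; last by rewrite z.
  rewrite avgZ mul0r normr0 (eq_avg (g := fun v => 0 * F v)) => [|v]; last by rewrite z !mul0r.
  by rewrite avgZ mul0r.
apply: le_trans (_ : \sum_(B | box_ok B) (avg (fun v => in_box B v * `|F v - G v|) + rho) <= _).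
  apply: ler_sum => B okB; rewrite boxF//.
  rewrite (eq_avg (g := fun v => in_box B v * (F v - G v) + in_box B v * G v)) => [|v]; last by ring.
  rewrite avgD; apply: le_trans (ler_normD _ _) _; apply: lerD; last exact: hG.
  apply: le_trans (ler_norm_avg _) _; apply: ler_avg => v.
  by rewrite normrM ger0_norm// in_boxE ler0n.
rewrite big_split /=; apply: lerD.
  rewrite -avg_sum; apply: ler_avg => v; rewrite -mulr_suml ler_piMl//.
  have [/existsP[B0 /andP[ok0 v0]]|] := boolP [exists B, box_ok B && [forall j, v j \in B j]].
    rewrite (bigD1 B0)//= in_boxE v0 big1 ?addr0// => B /andP[okB nB].
    rewrite in_boxE; case: forallP => // vB; case/negP: nB; apply/eqP/ffunP => j.
    case/andP: ok0 => /forallP B0P _; case/andP: okB => /forallP BP _; case/andP: bP => tP _.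
    by rewrite -(finset.def_pblock tP (BP j) (vB j)) (finset.def_pblock tP (B0P j) (forallP v0 j)).
  rewrite negb_exists => /forallP no; rewrite big1 // => B okB.
  by have := no B; rewrite okB /= in_boxE => /negbTE->.
rewrite sumr_const -[X in X <= _]mulr_natl ler_wpM2r// ler_nat; exact: card_box_ok.
Qed.
End BlockL1.

(** * Step kernels *)

Section StepKernel.
Variables (R : realType) (h : nat) (H : sgraph 'I_h).

Definition induced_kernel (V : finType) (w : V -> V -> R) (e : 'I_h * 'I_h) (x y : V) : R :=
  kern (H e.1 e.2) (w x y).

Definition adj_kernel (V : finType) (G : sgraph V) (x y : V) : R := (G x y)%:R.

Lemma pairprod_adj (V : finType) (G : sgraph V) (v : {ffun 'I_h -> V}) :
  pairprod (induced_kernel (adj_kernel G)) v =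
  [forall i, forall j, (i != j) ==> (G (v i) (v j) == H i j)]%:R.
Proof.
have kE e x y : induced_kernel (adj_kernel G) e x y = (G x y == H e.1 e.2)%:R.
  by rewrite /induced_kernel /adj_kernel; case: (H _ _); case: (G _ _); rewrite /= ?subrr ?subr0.
case: forallP => [ind|/forallP].
  rewrite /pairprod big1 // => -[i j] /= ij; rewrite kE /=.
  have /forallP/(_ j) := ind i; rewrite -val_eqE neq_ltn ij /= => /eqP->.
  by rewrite eqxx.
rewrite negb_forall => /existsP[i]; rewrite negb_forall => /existsP[j].
rewrite negb_imply => /andP[]; rewrite -val_eqE neq_ltn => /orP[ij|ji] Gij.
  by rewrite /pairprod (bigD1 (i, j))//= kE (negbTE Gij) mul0r.
by rewrite /pairprod (bigD1 (j, i))//= kE /= adj_sym (adj_sym H) (negbTE Gij) mul0r.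
Qed.

Lemma avg_in_box (V : finType) (U : 'I_h -> {set V}) (m : nat) :
  (forall i, #|U i| = m) ->
  avg (in_box R U) = m%:R ^+ h / #|V|%:R ^+ h.
Proof.
move=> Um; rewrite /avg card_ffun card_ord natrX; congr (_ / _).
rewrite -(bigA_distr_bigA (fun (j : 'I_h) x => (x \in U j)%:R)) /=.
rewrite (eq_bigr (fun=> m%:R)) => [|j _]; first by rewrite prodr_const card_ord.
by rewrite -natr_sum -big_mkcond /= sum1_card Um.
Qed.

Lemma avg_induced (V : finType) (G : sgraph V) (U : 'I_h -> {set V}) :
  avg (fun v => in_box R U v * pairprod (induced_kernel (adj_kernel G)) v) =
  (induced_copies H G 1%g U)%:R / #|V|%:R ^+ h.
Proof.
rewrite /avg card_ffun card_ord natrX; congr (_ / _).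
rewrite /induced_copies -sum1_card natr_sum [RHS]big_mkcond /=; apply: eq_bigr => v _.
rewrite pairprod_adj inE in_boxE -natrM mulnb.
have <- : [forall i, v i \in U ((1%g : {perm 'I_h}) i)] = [forall j, v j \in U j].
  by apply: eq_forallb => i; rewrite perm1.
by case: (_ && _).
Qed.

(** Rows and columns are partitioned by the same atoms, so exchanging the coordinates maps cells to
    cells. *)
Lemma smooth_sym (V : finType) (s : seq {set V}) (A : V * V -> R) x y :
  (forall x y, A (x, y) = A (y, x)) -> smooth s A (x, y) = smooth s A (y, x).
Proof.
move=> AC; have bC (q : V * V) (x' y' : V) : (box s (swap_pair q) == box s (x', y')) = (box s q == box s (y', x')).
  by rewrite /box /= !xpair_eqE andbC.
rewrite /smooth /cond_exp; congr (_ / _).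
  rewrite (reindex_inj (can_inj (@swap_pairK V V))) /=.
  by apply: eq_big => [q|[a b] _]; [exact: bC | rewrite AC].
rewrite -!sum1_card (reindex_inj (can_inj (@swap_pairK V V))) /=.
by congr (_%:R); apply: eq_bigl => q; rewrite !inE; exact: bC.
Qed.

Lemma avg_norm_le_of_sq (T : finType) (f : T -> R) (b : R) :
  0 <= b -> avg (fun t => f t ^+ 2) <= b ^+ 2 -> avg (fun t => `|f t|) <= b.
Proof.
move=> b0 hb; rewrite -(@ler_pXn2r _ 2%N) ?nnegrE//; last by apply: avg_ge0.
apply: le_trans (sqr_avg_le _) _; rewrite (eq_avg (g := fun t => f t ^+ 2))// => t.
by rewrite real_normK// num_real.
Qed.

Lemma exists_step_kernel (d eta : R) : (2 <= h)%N -> 0 < d <= 1 -> 0 < eta ->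
  exists2 delta : R, 0 < delta & exists N : nat, forall (V : finType) (G : sgraph V),
    (N <= #|V|)%N -> (0 < #|V|)%N ->
    (forall (m : nat) (U : 'I_h -> {set V}), (1 <= m)%N ->
       (forall i j : 'I_h, i != j -> [disjoint U i & U j]) ->
       (forall i, #|U i| = m) ->
       `|avg (fun v => in_box R U v *
            (pairprod (induced_kernel (adj_kernel G)) v - d))| <= delta) ->
  exists w : V -> V -> R, [/\ forall x y, w x y = w y x, forall x y, 0 <= w x y <= 1,
    avg (fun v => `|pairprod (induced_kernel w) v - d|) <= eta &
    cut_le eta (fun q => adj_kernel G q.1 q.2 - w q.1 q.2)].
Proof.
move=> h2 /andP[d0 d1] eta0.
have h0 : 0 < h%:R :> R by rewrite ltr0n ltnW.
have hh0 : 0 < (h * h)%:R :> R by rewrite ltr0n muln_gt0 ltnW.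
have hh1 : 1 <= (h * h)%:R :> R by rewrite ler1n muln_gt0 ltnW.
(* [eta] is split into thirds: [theta] serves for uncovered vertices and repeated blocks, [b] for
   the distance of the coarse from the fine kernel, [eps] and [delta] for the sum over boxes. [Q s]
   bounds the number of blocks when [s] sets generate the partition. *)
pose theta : R := eta / (6 * (h * h)%:R).
have theta0 : 0 < theta by rewrite divr_gt0// mulr_gt0.
pose Q (s : nat) : R := 2 * (2 ^ s)%:R / theta.
have k0 (s : nat) : 0 < (2 ^ s)%:R :> R by rewrite ltr0n expn_gt0.
have Q0 s : 0 < Q s by rewrite divr_gt0// mulr_gt0.
have Qh0 s : 0 < Q s ^+ h by rewrite exprn_gt0.
pose eps s := Num.min (eta / 2) (eta / 6 / (Q s ^+ h * (h * h)%:R)).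
have eps0 s : 0 < eps s by rewrite lt_min !divr_gt0// mulr_gt0.
pose b := eta / (3 * (h * h)%:R).
have b0 : 0 < b by rewrite divr_gt0// mulr_gt0.
have [K hK] := strong_regularity (exprn_gt0 2 b0) eps0.
pose delta := eta / 6 / Q K ^+ h.
have delta0 : 0 < delta by rewrite !divr_gt0.
(* Having n at least [Q K] makes x >= 2 below, so that the block size m is positive and at least x /
   2. *)
exists delta => //; exists (Num.bound (Q K)) => V G NV V0 hG.
pose A (q : V * V) := adj_kernel G q.1 q.2.
have A01 q : 0 <= A q <= 1 by rewrite /A /adj_kernel; case: (G _ _); rewrite /= ler01 lexx.
have AC x y : A (x, y) = A (y, x) by rewrite /A /adj_kernel /= adj_sym.
have [s [t [sK cutW en]]] := hK V A V0 A01.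
set n : R := #|V|%:R.
have n0 : 0 < n by rewrite ltr0n.
have Qn : Q (size s) <= n.
  apply: le_trans (_ : Q K <= n).
    by rewrite ler_pM2r ?invr_gt0// ler_pM2l// ler_nat leq_exp2l.
  by apply: ltW; apply: lt_le_trans (archi_boundP (ltW (Q0 K))) _; rewrite ler_nat.
pose w x y := smooth s A (x, y).
pose W x y := smooth (t ++ s) A (x, y).
have w01 x y : 0 <= w x y <= 1 by apply: cond_exp01.
have W01 x y : 0 <= W x y <= 1 by apply: cond_exp01.
have wW : avg (fun q => `|w q.1 q.2 - W q.1 q.2|) <= b.
  apply: avg_norm_le_of_sq; first exact: ltW.
  rewrite (eq_avg (g := fun q => (smooth (t ++ s) A q - smooth s A q) ^+ 2)) => [|[x y]].
    by rewrite avg_smooth_sqB.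
  by rewrite /w /W /=; ring.
exists w; split=> //; first by move=> x y; apply: smooth_sym.
  (* m is the largest size for which leftovers of up to m points in each of the 2^(size s) colours
     amount to at most theta n. *)
  pose x := theta * n / (2 ^ size s)%:R.
  pose m := Num.truncn x.
  have x2 : 2 <= x.
    move: Qn; rewrite /Q /x ler_pdivrMr// => Qn.
    by rewrite ler_pdivlMr// [theta * n]mulrC.
  have x0 : 0 <= x by lra.
  have /andP[mx xm] := truncn_itv x0; rewrite -/m in mx xm.
  have xm2 : x / 2 <= m%:R by move: xm; rewrite -addn1 natrD; lra.
  have m0 : (0 < m)%N by rewrite -(ltr_nat R); lra.
  (* The atom as a tuple of fixed length, which makes the colours a finite type. *)
  pose c (z : V) : (size s).-tuple bool := [tuple of map (fun U : {set V} => z \in U) (in_tuple s)].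
  have [P bP rP] := exists_blocks c m0.
  pose F (v : {ffun 'I_h -> V}) := pairprod (induced_kernel w) v - d.
  pose G' (v : {ffun 'I_h -> V}) := pairprod (induced_kernel W) v - d.
  have kw01 e y z : 0 <= induced_kernel w e y z <= 1 by apply: kern01.
  have kW01 e y z : 0 <= induced_kernel W e y z <= 1 by apply: kern01.
  have kA01 e y z : 0 <= induced_kernel (adj_kernel G) e y z <= 1 by apply: kern01; apply: (A01 (y, z)).
  have F1 v : `|F v| <= 1.
    have /andP[? ?] := pairprod01 kw01 v.
    by rewrite /F ler_norml; apply/andP; split; lra.
  have Fc (v v' : {ffun 'I_h -> V}) : (forall i, c (v i) = c (v' i)) -> F v = F v'.
    move=> cv; congr (_ - _); apply: eq_bigr => e _; congr kern.
    apply: cond_exp_key; rewrite /box /atom /=.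
    by have := (congr1 val (cv e.1), congr1 val (cv e.2)) => -[/= -> ->].
  pose rho := (h * h)%:R * eps (size s) + delta.
  have rho0 : 0 <= rho by apply: addr_ge0; [apply: mulr_ge0; [exact: ltW | exact: ltW (eps0 _)] | exact: ltW].
  have hrho (B : {ffun 'I_h -> {set V}}) : box_ok P B -> `|avg (fun v => in_box R B v * G' v)| <= rho.
    move=> /andP[/forallP BP /injectiveP Binj].
    rewrite (eq_avg (g := fun v => in_box R B v * (pairprod (induced_kernel W) v - pairprod (induced_kernel (adj_kernel G)) v)
      + in_box R B v * (pairprod (induced_kernel (adj_kernel G)) v - d))) => [|v]; last by rewrite /G'; ring.
    rewrite avgD; apply: le_trans (ler_normD _ _) _; apply: lerD.
      apply: counting => //; first exact: ltW.
      move=> e S T; rewrite /induced_kernel.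
      have [Hb|Hb] := boolP (H e.1 e.2).
        rewrite (eq_avg (g := fun q => -1 * ((A q - smooth (t ++ s) A q) * rect R S T q))) => [|[y z]].
          by rewrite avgZ mulN1r normrN.
        by rewrite /A /W /=; ring.
      rewrite (eq_avg (g := fun q => (A q - smooth (t ++ s) A q) * rect R S T q)) => [|[y z]] //.
      by rewrite /A /W /=; ring.
    apply: (hG m) => // [i j ij|i]; last exact: (card_block bP (BP i)).
    case/andP: (bP) => /finset.trivIsetP tP _; apply: tP => //.
    by apply: contraNneq ij => /Binj ->.
  have := avg_norm_blocks V0 bP rP F1 Fc hrho rho0.
  rewrite -/n card_tuple card_bool => hF; apply: le_trans hF _.
  have i1 : h%:R * ((2 ^ size s)%:R * m%:R / n) + (h * h)%:R * (m%:R / n) <= eta / 3.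
    have mn : (2 ^ size s)%:R * m%:R / n <= theta.
      by rewrite ler_pdivrMr// mulrC -ler_pdivlMr.
    have mn' : m%:R / n <= (2 ^ size s)%:R * m%:R / n.
      by rewrite -mulrA ler_peMl ?divr_ge0 ?ler0n//; last by rewrite ler1n expn_gt0.
    have hle : h%:R <= (h * h)%:R :> R by rewrite ler_nat leq_pmulr// ltnW.
    apply: le_trans (_ : (h * h)%:R * theta + (h * h)%:R * theta <= _).
      apply: lerD; last by rewrite ler_pM2l// (le_trans mn').
      by apply: ler_pM; rewrite ?ler0n// !mulr_ge0 ?ler0n ?invr_ge0// ltW.
    by rewrite /theta le_eqVlt; apply/orP; left; apply/eqP; field; rewrite gt_eqF.
  have i2 : avg (fun v => `|F v - G' v|) <= eta / 3.
    rewrite (eq_avg (g := fun v => `|pairprod (induced_kernel w) v - pairprod (induced_kernel W) v|)) => [|v].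
      apply: le_trans (avg_pairprod_dist V0 (eps := b) kw01 kW01 _) _.
        move=> e; rewrite (eq_avg (g := fun q => `|w q.1 q.2 - W q.1 q.2|))// => q.
        exact: kern_dist.
      by rewrite /b le_eqVlt; apply/orP; left; apply/eqP; field; rewrite gt_eqF.
    by rewrite /F /G'; congr `|_|; ring.
  have PQ : #|P|%:R <= Q (size s).
    have Pm : #|P|%:R * m%:R <= n by rewrite -natrM ler_nat (card_blocks_le bP).
    have : #|P|%:R * (x / 2) <= n by apply: le_trans Pm; rewrite ler_wpM2l ?ler0n.
    have -> : x / 2 = n / Q (size s).
      by rewrite /x /Q; field; rewrite !gt_eqF.
    by rewrite mulrA ler_pdivrMr// mulrC ler_pM2l.
  have i3 : (#|P| ^ h)%:R * rho <= eta / 3.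
    rewrite natrX; apply: le_trans (_ : Q (size s) ^+ h * rho <= _).
      by rewrite ler_wpM2r// lerXn2r// ?nnegrE ?ler0n// ltW.
    rewrite mulrDr.
    have j1 : Q (size s) ^+ h * ((h * h)%:R * eps (size s)) <= eta / 6.
      rewrite mulrA mulrC -ler_pdivlMr ?mulr_gt0//.
      by rewrite /eps ge_min lexx orbT.
    have j2 : Q (size s) ^+ h * delta <= eta / 6.
      apply: le_trans (_ : Q K ^+ h * delta <= _).
        rewrite (ler_pM2r delta0) lerXn2r ?nnegrE ?(ltW (Q0 _))//.
        by rewrite ler_pM2r ?invr_gt0// ler_pM2l// ler_nat leq_exp2l.
      by rewrite /delta mulrC divfK// gt_eqF.
    lra.
  lra.
move=> S T.
rewrite (eq_avg (g := fun q => (A q - smooth (t ++ s) A q) * rect R S T q + (W q.1 q.2 - w q.1 q.2) * rect R S T q)) => [|[y z]]; last first.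
  by rewrite /A /w /W /=; ring.
rewrite avgD; apply: le_trans (ler_normD _ _) _.
have c1 : `|avg (fun q => (A q - smooth (t ++ s) A q) * rect R S T q)| <= eta / 2.
  by apply: le_trans (cutW S T) _; rewrite /eps ge_min lexx.
have c2 : `|avg (fun q => (W q.1 q.2 - w q.1 q.2) * rect R S T q)| <= b.
  apply: le_trans (ler_norm_avg _) _; apply: le_trans wW; apply: ler_avg => q.
  rewrite normrM distrC ler_piMr// /rect.
  by case: (_ && _); rewrite ?normr1 ?normr0.
have : b <= eta / 3.
  by rewrite /b invfM mulrA ler_piMr ?invf_le1// ltW// divr_gt0.
lra.
Qed.
End StepKernel.

(** * From step kernels back to edge counts *)

Lemma avg_adj_rect (R : realType) (V : finType) (G : sgraph V) (U : {set V}) :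
  avg (fun q => adj_kernel R G q.1 q.2 * rect R U U q) =
  2 * (num_edges_in G U)%:R / #|V|%:R ^+ 2.
Proof.
rewrite /avg card_prod natrM -expr2 -natrM double_edges_in -sum1_card natr_sum.
congr (_ / _); rewrite [RHS]big_mkcond; apply: eq_bigr => q _ /=.
rewrite inE /adj_kernel /rect -natrM mulnb [andb (G _ _) _]andbC -andbA.
by case: (_ && _).
Qed.

Lemma avg_rect (R : realType) (V : finType) (U : {set V}) :
  avg (rect R U U) = #|U|%:R ^+ 2 / #|V|%:R ^+ 2.
Proof.
rewrite (eq_avg (g := fun q => (q.1 \in U)%:R * (q.2 \in U)%:R)) => [|q]; last first.
  by rewrite /rect -natrM mulnb.
rewrite (avg_prod (fun x => (x \in U)%:R) (fun x => (x \in U)%:R)) /avg.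
by rewrite -natr_sum -big_mkcond sum1_card mulrACA -invfM -!expr2.
Qed.

(** The rectangle U x U counts every edge twice, whence the budget 2 zeta for the cut distance, the
    L^1 distance and the error in the density. *)
Lemma eq_pm_of_step_kernel (R : realType) (V : finType) (G : sgraph V)
    (w : V -> V -> R) (a r z1 z2 z3 zeta : R) (U : {set V}) :
    (0 < #|V|)%N -> cut_le z1 (fun q => adj_kernel R G q.1 q.2 - w q.1 q.2) ->
    avg (fun q => `|w q.1 q.2 - a|) <= z2 -> `|a - r| <= z3 ->
    z1 + z2 + z3 <= 2 * zeta ->
  eq_pm (num_edges_in G U)%:R (2^-1 * r * #|U|%:R ^+ 2) (zeta * #|V|%:R ^+ 2).
Proof.
move=> V0 cutw wa ar hz; set n : R := #|V|%:R.
have n0 : 0 < n by rewrite ltr0n.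
have n20 : 0 < n ^+ 2 by rewrite exprn_gt0.
have VV0 : (0 < #|{: V * V}|)%N by rewrite card_prod muln_gt0 V0.
rewrite /eq_pm -ler_distl.
have key : `|avg (fun q => (adj_kernel R G q.1 q.2 - r) * rect R U U q)| <= z1 + (z2 + z3).
  rewrite (eq_avg (g := fun q => (adj_kernel R G q.1 q.2 - w q.1 q.2) * rect R U U q
      + (w q.1 q.2 - r) * rect R U U q)) => [|q]; last by ring.
  rewrite avgD; apply: le_trans (ler_normD _ _) _; apply: lerD; first exact: cutw.
  apply: le_trans (ler_norm_avg _) _; apply: le_trans (lerD wa ar).
  rewrite -(avg_cst `|a - r| VV0) -avgD; apply: ler_avg => q.
  apply: le_trans (ler_distD a (w q.1 q.2) r); rewrite normrM ler_piMr// /rect.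
  by case: (_ && _); rewrite ?normr1 ?normr0.
have e : avg (fun q => (adj_kernel R G q.1 q.2 - r) * rect R U U q) =
    2 / n ^+ 2 * ((num_edges_in G U)%:R - 2^-1 * r * #|U|%:R ^+ 2).
  rewrite (eq_avg (g := fun q => adj_kernel R G q.1 q.2 * rect R U U q + (- r) * rect R U U q)) => [|q]; last by ring.
  by rewrite avgD avgZ avg_adj_rect avg_rect -/n; field; rewrite gt_eqF.
move: key; rewrite e normrM ger0_norm; last by rewrite divr_ge0// ltW.
rewrite mulrAC ler_pdivrMr// => key.
have : (z1 + (z2 + z3)) * n ^+ 2 <= 2 * zeta * n ^+ 2 by rewrite ler_pM2r//; lra.
lra.
Qed.

Theorem theorem1p7 (R : realType) (p : R) (h : nat) (H : sgraph 'I_h)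
    (hp : 0 < p < 1) (hh : (2 <= h)%N) (zeta : R) (hzeta : 0 < zeta) :
  exists (delta : R) (N : nat), 0 < delta /\
    forall (n : nat) (V : finType) (G : sgraph V),
      #|V| = n -> (N <= n)%N ->
      (forall (m : nat) (U : 'I_h -> {set V}) (sigma : {perm 'I_h}),
          (1 <= m)%N ->
          (forall i j : 'I_h, i != j -> [disjoint U i & U j]) ->
          (forall i : 'I_h, #|U i| = m) ->
          eq_pm (induced_copies H G sigma U)%:R
                (ind_density H p * m%:R ^+ h) (delta * n%:R ^+ h)) ->
      (forall U : {set V},
          eq_pm (num_edges_in G U)%:R
                (2^-1 * p * #|U|%:R ^+ 2) (zeta * n%:R ^+ 2)) \/
      (forall U : {set V},
          eq_pm (num_edges_in G U)%:R
                (2^-1 * conj_density H p * #|U|%:R ^+ 2) (zeta * n%:R ^+ 2)).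
Proof.
have /andP[d0 d1] := ind_density_gt0_lt1 H hh hp.
have d01 : 0 < ind_density H p <= 1 by rewrite d0 ltW.
have [kappa k0 stable] := ind_density_stable H hh hp hzeta.
(* Of the budget 2 zeta, half is left to |a - r| and a quarter each to the L^1 and the cut
   distance. *)
pose kap := Num.min kappa (zeta / 2).
have kap0 : 0 < kap by rewrite lt_min k0 divr_gt0.
have [eta e0 near] := nearly_constant (fun e : 'I_h * 'I_h => H e.1 e.2) hh d01 kap0.
pose et := Num.min eta (zeta / 2).
have et0 : 0 < et by rewrite lt_min e0 divr_gt0.
have [delta delta0 [N step]] := exists_step_kernel H hh d01 et0.
exists delta, N.+1; split=> // n V G Vn Nn hG.
have V0 : (0 < #|V|)%N by rewrite Vn; apply: leq_ltn_trans Nn.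
have nh0 : 0 < n%:R ^+ h :> R by rewrite exprn_gt0// ltr0n -Vn.
have [|m U m1 dU mU|w [wC w01 wd wcut]] := step V G _ V0; first by rewrite Vn ltnW.
  have := hG m U 1%g m1 dU mU; rewrite /eq_pm -ler_distl => hm.
  rewrite (eq_avg (g := fun v => in_box R U v * pairprod (induced_kernel H (adj_kernel R G)) v
      + - ind_density H p * in_box R U v)) => [|v]; last by ring.
  rewrite avgD avgZ avg_induced (avg_in_box R mU) Vn mulNr mulrA -mulrBl normrM.
  by rewrite [X in _ * X]ger0_norm ?invr_ge0 ?(ltW nh0)// ler_pdivrMr.
have {}wd : avg (fun v => `|pairprod (induced_kernel H w) v - ind_density H p|) <= eta.
  by apply: le_trans wd _; rewrite ge_min lexx.
have [a a01 [aw]] := near V w V0 wC w01 wd; rewrite prod_kern => ad.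
have {}ad : `|ind_density H a - ind_density H p| <= kappa.
  by apply: le_trans ad _; rewrite ge_min lexx.
have sum : et + kap + zeta <= 2 * zeta.
  have : et <= zeta / 2 by rewrite ge_min lexx orbT.
  have : kap <= zeta / 2 by rewrite ge_min lexx orbT.
  lra.
by case: (stable a a01 ad) => ar; [left | right] => U; rewrite -Vn;
  apply: (eq_pm_of_step_kernel U V0 wcut aw ar).
Qed.
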